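(* Let $K$ be a compact Hausdorff space and let $X$ be a Banach space with property $(\alpha)$. Then any bounded homomorphism $u\colon C(K)\to B(X)$ is matricially $R$-bounded, that is, there is a constant $C\geq 0$ such that for any $n\geq 1$ and any $[f_{ij}]\in M_n(C(K))$, $$\bigl\Vert[u(f_{ij})]\bigr\Vert_R\leq C\,\bigl\Vert[f_{ij}]\bigr\Vert_{C(K;M_n)}.$$
   Context: $C(K)$ is the algebra of continuous functions $K\to\mathbb{C}$ with the supremum norm, $B(X)$ the algebra of bounded operators on the complex Banach space $X$; a bounded homomorphism is a bounded linear multiplicative map (not assumed unital). $M_n$ is the algebra of complex $n\times n$ matrices with the operator norm on $\ell^2_n$; $M_n(C(K))$ is identified with $C(K;M_n)$, with norm $\sup_{t\in K}\Vert[f_{ij}(t)]\Vert_{M_n}$. Let $(\epsilon_k)_{k\geq1}$ be independent Rademacher variables on a probability space $\Omega_0$ and put $\Vert\sum_k\epsilon_k\otimes x_k\Vert_{\mathrm{Rad}(X)}=\bigl(\int_{\Omega_0}\Vert\sum_k\epsilon_k(\lambda)x_k\Vert_X^2\,d\lambda\bigr)^{1/2}$; $\mathrm{Rad}(X)$ is the closure of the span of the $\epsilon_k\otimes x$ in $L^2(\Omega_0;X)$. For $[T_{ij}]\in M_n(B(X))$, $$\bigl\Vert[T_{ij}]\bigr\Vert_R=\sup\Bigl\{\Bigl\Vert\sum_{i,j=1}^n\epsilon_i\otimes T_{ij}(x_j)\Bigr\Vert_{\mathrm{Rad}(X)}: x_1,\dots,x_n\in X,\ \Bigl\Vert\sum_{j=1}^n\epsilon_j\otimes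 x_j\Bigr\Vert_{\mathrm{Rad}(X)}\leq1\Bigr\}.$$ $X$ has property $(\alpha)$ if there is $C\geq1$ such that for all finite families $(x_{ij})$ in $X$ and $(t_{ij})$ in $\mathbb{C}$, $$\Bigl\Vert\sum_{i,j}\epsilon_i\otimes\epsilon_j\otimes t_{ij}x_{ij}\Bigr\Vert_{\mathrm{Rad}(\mathrm{Rad}(X))}\leq C\sup_{i,j}|t_{ij}|\,\Bigl\Vert\sum_{i,j}\epsilon_i\otimes\epsilon_j\otimes x_{ij}\Bigr\Vert_{\mathrm{Rad}(\mathrm{Rad}(X))}.$$ *)

(* Defs.v *)
From HB Require Import structures.
From mathcomp Require Import all_boot all_order all_algebra finmap.
From mathcomp Require Import complex.
From mathcomp Require Import all_classical all_reals all_analysis.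

Set Implicit Arguments.
Unset Strict Implicit.
Unset Printing Implicit Defensive.

Import Order.TTheory GRing.Theory Num.Theory.
Import numFieldNormedType.Exports.

Local Open Scope classical_set_scope.
Local Open Scope complex_scope.
Local Open Scope ring_scope.

(* The library norm of a complex normed space takes its values in R[i] (on the
   nonnegative real axis); nrm is the same norm as an element of R. *)
Definition nrm (R : realType) (V : normedZmodType R[i]) (v : V) : R :=
  complex.Re `|v|.

(* F^o is F with the topology of its norm; for F = R[i], CK R[i] K is the
   algebra of complex continuous functions on K, with pointwise operations. *)
Section continuous_functions.
Context (F : numFieldType) (K : topologicalType).

Definition cfun : {pred K -> F^o} := mem [set f : K -> F^o | continuous f].

Lemma cfunP (f : K -> F^o) : reflect (continuous f) (f \in cfun).
Proof. by apply: (iffP idP); rewrite /cfun inE. Qed.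

Lemma cfun_subring_closed : subring_closed cfun.
Proof.
split=> [|f g /cfunP cf /cfunP cg|f g /cfunP cf /cfunP cg]; apply/cfunP => t.
- exact: cst_continuous.
- exact: (@continuousB F F^o K f g t (cf t) (cg t)).
- exact: (@continuousM F K f g t (cf t) (cg t)).
Qed.

HB.instance Definition _ :=
  GRing.isSubringClosed.Build (K -> F^o) cfun cfun_subring_closed.

Lemma cfun_scaler_closed : scaler_closed cfun.
Proof.
move=> a f /cfunP cf; apply/cfunP => t.
exact: (@continuousZl_tmp F F^o K f a t (cf t)).
Qed.

HB.instance Definition _ :=
  GRing.isScaleClosed.Build F (K -> F^o) cfun cfun_scaler_closed.

Record CK := MkCK { CK_fun :> K -> F^o ; CK_in : CK_fun \in cfun }.

HB.instance Definition _ := [isSub for CK_fun].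
HB.instance Definition _ := [Choice of CK by <:].
HB.instance Definition _ :=
  GRing.SubChoice_isSubComPzRing.Build (K -> F^o) cfun CK cfun_subring_closed.
HB.instance Definition _ := [SubZmodule_isSubLmodule of CK by <:].

End continuous_functions.
Arguments CK : clear implicits.

Section operators.
Context (R : realType).

Record BX (X : normedModType R[i]) := MkBX {
  BX_fun :> {linear X -> X} ;
  BX_bounded : exists M : R, forall x, nrm (BX_fun x) <= M * nrm x }.

Definition opnorm (X : normedModType R[i]) (T : BX X) : \bar R :=
  ereal_sup [set (nrm (T x))%:E | x in [set x : X | nrm x <= 1]].

(* On an empty K this is sup set0 = 0, as it should be. *)
Definition supnorm (K : topologicalType) (f : CK R[i] K) : R :=
  sup [set nrm (f t) | t in [set: K]].

(* "Homomorphism" does not include u 1 = 1. *)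
Definition bounded_homomorphism (K : topologicalType) (X : normedModType R[i])
    (u : CK R[i] K -> BX X) : Prop :=
  [/\ forall a f g x, u (a *: f + g) x = a *: u f x + u g x,
      forall f g x, u (f * g) x = u f (u g x) &
      exists M : R, forall f, (opnorm (u f) <= (M * supnorm f)%:E)%E].

Definition l2norm n (v : 'cV[R[i]]_n) : R :=
  Num.sqrt (\sum_(i < n) nrm (v i ord0) ^+ 2).

Definition mxopnorm n (A : 'M[R[i]]_n) : R :=
  sup [set l2norm (A *m v) | v in [set v : 'cV[R[i]]_n | l2norm v <= 1]].

Definition mxsupnorm (K : topologicalType) n (F : 'M[CK R[i] K]_n) : R :=
  sup [set mxopnorm (\matrix_(i, j) (F i j t : R[i])) | t in [set: K]].

End operators.

Section rademacher.
Context d (Omega : measurableType d) (R : realType) (P : probability Omega R).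
Variable eps : nat -> {RV P >-> R}.

Definition mutually_independent : Prop :=
  forall (J : {fset nat}) (A : nat -> set R), (forall k, measurable (A k)) ->
    (P (\bigcap_(k in [set` J]) (eps k @^-1` A k)) =
     \prod_(k <- J) P (eps k @^-1` A k))%E.

Definition rademacher_sequence : Prop :=
  mutually_independent /\
  forall k, distribution P (eps k) [set 1] = (2^-1)%:E /\
            distribution P (eps k) [set -1] = (2^-1)%:E.

Definition tens (E : lmodType R[i]) (k : nat) (x : E) : Omega -> E :=
  fun w => (eps k w)%:C *: x.

(* The norm of L^2(Omega; E), for the norm N on E.  It is applied only to
   finite Rademacher sums, on which the integrand is a.s. bounded. *)
Definition L2norm (E : Type) (N : E -> R) (f : Omega -> E) : R :=
  Num.sqrt (\int[P]_w (N (f w)) ^+ 2).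

Context (X : normedModType R[i]).

Definition Rad_norm : (Omega -> X) -> R := L2norm (@nrm R X).

(* An element of Rad(Rad(X)) is a function on Omega with values in functions
   on Omega. *)
Definition RadRad_norm : (Omega -> Omega -> X) -> R := L2norm Rad_norm.

Definition R_norm n (T : 'I_n -> 'I_n -> BX X) : \bar R :=
  ereal_sup
    [set (Rad_norm (\sum_(i < n) \sum_(j < n) tens i (T i j (x j))))%:E
    | x in [set x : 'I_n -> X | Rad_norm (\sum_(j < n) tens j (x j)) <= 1]].

Definition property_alpha : Prop :=
  exists2 C : R, 1 <= C &
    forall m n (x : 'I_m -> 'I_n -> X) (t : 'I_m -> 'I_n -> R[i]),
      RadRad_norm (\sum_(i < m) \sum_(j < n) tens i (tens j (t i j *: x i j)))
      <= C * (\big[Num.max/0]_(ij : 'I_m * 'I_n) nrm (t ij.1 ij.2))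
         * RadRad_norm (\sum_(i < m) \sum_(j < n) tens i (tens j (x i j))).

End rademacher.

(* Main.v *)
Require Import Defs.
From mathcomp Require Import all_boot all_order all_algebra finmap complex.
From mathcomp Require Import all_classical all_reals all_analysis.
From mathcomp Require Import measurable_realfun.
From mathcomp Require Import ring lra zify.

Set Implicit Arguments.
Unset Strict Implicit.
Unset Printing Implicit Defensive.

Import Order.TTheory GRing.Theory Num.Theory.
Import numFieldNormedType.Exports.

Local Open Scope classical_set_scope.
Local Open Scope complex_scope.
Local Open Scope ring_scope.

(* Up to a small error, F is an average over s of sums over k of psi_k^2 F(t_k),
   where for each s the psi_k have disjoint supports; they arise by cutting K
   along the level sets of the entries of F.  Disjointness gives
   sum_k u(psi_k^2) z_k = u(sum_k e_k psi_k) (sum_k e_k u(psi_k) z_k) for all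
   signs e_k, and averaging over the signs reduces the claim to
   |sum_{k,i} e_k e'_i sum_j F_ij(t_k) y_kj| <= C |F| |sum_{k,j} e_k e'_j y_kj|
   in Rad(Rad(X)), with y_kj = u(psi_k) x_j.  By property (alpha) the products
   e_k e'_i may be replaced by independent signs e_ki, so that it remains to show
   |sum_p e_p sum_q A_pq y_q| <= C |A| |sum_q e_q y_q| for scalar matrices A.

   For Gaussian variables this would be clear from rotation invariance, after
   extending A/|A| to a matrix Z with orthonormal rows.  Gaussian variables are
   replaced by h_q = N^{-1/2} (e_1q + ... + e_Nq): by property (alpha),
   |sum_q h_q y_q| <= C |sum_q e_q y_q| uniformly in N.  Conversely, let
   W_d = prod_p (1 + d_p sin (Zh)_p) for signs d_p.  Then W_d >= 0, the average
   of W_d over d is 1, and as N tends to infinity E W_d -> 1 and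
   E[W_d h_q] -> e^{-1/2} sum_p d_p Z_pq, because the characteristic function of
   h is a product of cosines.  Hence e^{-1/2} sum_p d_p sum_q Z_pq y_q is the
   limit of E[W_d sum_q h_q y_q], and Jensen's inequality concludes. *)

(** * Norms and finite averages *)

Section nrm_theory.
Context (R : realType) (V : normedModType R[i]).
Implicit Types (x y : V) (r : R).

Lemma nrmE x : `|x| = (nrm x)%:C.
Proof. by rewrite /nrm RRe_real// ger0_real. Qed.

Lemma nrm_ge0 x : 0 <= nrm x.
Proof. by rewrite -ler0c -nrmE. Qed.

Lemma ler_nrmD x y : nrm (x + y) <= nrm x + nrm y.
Proof. by rewrite -lecR rmorphD/= -!nrmE ler_normD. Qed.

Lemma nrm0 : nrm (0 : V) = 0.
Proof. by rewrite /nrm normr0. Qed.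

Lemma nrmZ (a : R[i]) x : nrm (a *: x) = nrm (a : R[i]^o) * nrm x.
Proof. by apply: complexI; rewrite rmorphM/= -!nrmE normrZ. Qed.

Lemma nrm_eq0 x : nrm x = 0 -> x = 0.
Proof. by move=> h; apply/eqP; rewrite -normr_eq0 nrmE h. Qed.

Lemma ler_nrm_sum I (s : seq I) (P : pred I) (F : I -> V) :
  nrm (\sum_(i <- s | P i) F i) <= \sum_(i <- s | P i) nrm (F i).
Proof.
elim/big_ind2 : _ => [|x a y b ha hb|//]; first by rewrite nrm0.
by apply: (le_trans (ler_nrmD _ _)); apply: lerD.
Qed.

End nrm_theory.

Lemma nrmC (R : realType) (z : R[i]) :
  nrm (z : R[i]^o) = Num.sqrt (complex.Re z ^+ 2 + complex.Im z ^+ 2).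
Proof. by rewrite /nrm normc_def. Qed.

Lemma nrmR (R : realType) (r : R) : nrm (r%:C : R[i]^o) = `|r|.
Proof. by rewrite nrmC /= expr0n addr0 sqrtr_sqr. Qed.

Lemma nrmZR (R : realType) (V : normedModType R[i]) (r : R) (x : V) :
  nrm (r%:C *: x) = `|r| * nrm x.
Proof. by rewrite nrmZ nrmR. Qed.

(** Cauchy-Schwarz: by Lagrange's identity, twice the difference of the two sides is the sum of
    [w s * w t * (a s - a t) ^+ 2]. *)
Lemma sqr_sum_le_weighted (R : realFieldType) (T : finType) (w a : T -> R) :
  (forall t, 0 <= w t) ->
  (\sum_t w t * a t) ^+ 2 <= (\sum_t w t) * \sum_t w t * a t ^+ 2.
Proof.
move=> w0.
have : 0 <= \sum_s \sum_t w s * w t * (a s - a t) ^+ 2.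
  apply: sumr_ge0 => s _; apply: sumr_ge0 => t _; rewrite mulr_ge0 ?sqr_ge0 ?mulr_ge0 ?w0 //.
have -> : \sum_s \sum_t w s * w t * (a s - a t) ^+ 2 =
   2 * ((\sum_t w t) * (\sum_t w t * a t ^+ 2) - (\sum_t w t * a t) ^+ 2).
  under eq_bigr => s _ do under eq_bigr => t _ do
    have -> : w s * w t * (a s - a t) ^+ 2 = w s * a s ^+ 2 * w t +
       w s * (w t * a t ^+ 2) - (w s * a s) * (w t * a t) * 2 by ring.
  under eq_bigr => s _ do rewrite sumrB big_split/= -!mulr_sumr -mulr_suml -mulr_sumr.
  rewrite sumrB big_split/= -!mulr_suml.
  ring.
by rewrite pmulr_rge0// subr_ge0.
Qed.

(** Jensen's inequality for the squared norm, with weights of arbitrary total mass; the Riesz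
    products, whose mean is only close to 1, will serve as weights. *)
Lemma nrm_sum_sqr_le (R : realType) (X : normedModType R[i]) (T : finType)
    (w : T -> R) (z : T -> X) : (forall t, 0 <= w t) ->
  nrm (\sum_t (w t)%:C *: z t) ^+ 2 <=
  (\sum_t w t) * \sum_t w t * nrm (z t) ^+ 2.
Proof.
move=> w0; apply: le_trans (sqr_sum_le_weighted (fun t => nrm (z t)) w0).
rewrite ler_sqr ?nnegrE ?nrm_ge0// ?sumr_ge0//; last first.
  by move=> t _; rewrite mulr_ge0 ?nrm_ge0.
apply: le_trans (ler_nrm_sum _ _ _) _; apply: ler_sum => t _.
by rewrite nrmZR ger0_norm.
Qed.

Lemma nrm_sqrD_le (R : realType) (X : normedModType R[i]) (x y : X) :
  nrm (x + y) ^+ 2 <= 2 * (nrm x ^+ 2 + nrm y ^+ 2).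
Proof.
have := @nrm_sum_sqr_le R X bool (fun=> 1) (fun b => if b then x else y) (fun=> ler01).
by rewrite !big_bool/= rmorph1 !scale1r !mul1r.
Qed.

(** On an empty [T] the value is 0, because the inverse of 0 is 0. *)
Definition avg (R : fieldType) (T : finType) (f : T -> R) : R :=
  #|T|%:R^-1 * \sum_t f t.

Section avg_field.
Context (R : fieldType).
Implicit Types T S : finType.

Lemma eq_avg T (f g : T -> R) : f =1 g -> avg f = avg g.
Proof. by move=> fg; rewrite /avg (eq_bigr g). Qed.

Lemma avgZ T (f : T -> R) a : avg (fun t => a * f t) = a * avg f.
Proof. by rewrite /avg -mulr_sumr mulrCA. Qed.

Lemma avgD T (f g : T -> R) : avg (fun t => f t + g t) = avg f + avg g.
Proof. by rewrite /avg big_split/= mulrDr. Qed.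

Lemma exchange_avg T S (f : T -> S -> R) :
  avg (fun t => avg (f t)) = avg (fun s => avg (f ^~ s)).
Proof.
rewrite /avg -!mulr_sumr exchange_big/=; ring.
Qed.

Lemma avg_sum T S (f : T -> S -> R) :
  avg (fun t => \sum_s f t s) = \sum_s avg (f ^~ s).
Proof. by rewrite /avg exchange_big/= mulr_sumr. Qed.

Lemma reindex_avg T S (h : S -> T) (f : T -> R) :
  bijective h -> avg f = avg (f \o h).
Proof.
move=> bh; rewrite /avg (bij_eq_card bh); congr (_ * _).
by rewrite (reindex h)//; exact: onW_bij.
Qed.

(** The coordinates of a uniformly distributed sign pattern are independent. *)
Lemma avg_prod (I : finType) (f : I -> bool -> R) :
  avg (fun w : {ffun I -> bool} => \prod_i f i (w i)) = \prod_i avg (f i).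
Proof.
rewrite /avg big_split/= card_ffun prodr_const card_bool natrX exprVn.
by congr (_ * _); rewrite bigA_distr_bigA.
Qed.

End avg_field.

Lemma rmorph_avg (R S : fieldType) (phi : {rmorphism R -> S}) (T : finType)
    (f : T -> R) : phi (avg f) = avg (fun t => phi (f t)).
Proof. by rewrite /avg rmorphM fmorphV rmorph_nat rmorph_sum. Qed.

Section avg_order.
Context (R : realFieldType).
Implicit Types T : finType.

Lemma avg_ge0 T (f : T -> R) : (forall t, 0 <= f t) -> 0 <= avg f.
Proof. by move=> f0; rewrite mulr_ge0 ?invr_ge0// sumr_ge0. Qed.

Lemma ler_avg T (f g : T -> R) : (forall t, f t <= g t) -> avg f <= avg g.
Proof. by move=> fg; rewrite ler_wpM2l ?invr_ge0// ler_sum. Qed.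

Lemma avg_cst T (a : R) : (0 < #|T|)%N -> avg (fun _ : T => a) = a.
Proof.
move=> T0; rewrite /avg sumr_const -[a *+ _]mulr_natl mulKf//.
by rewrite pnatr_eq0 -lt0n.
Qed.

Lemma avg_le T (f : T -> R) a : 0 <= a -> (forall t, f t <= a) -> avg f <= a.
Proof.
move=> a0 fa; apply: (le_trans (ler_avg fa)).
have [/eqP T0|T0] := posnP #|T|; last by rewrite avg_cst.
by rewrite /avg (eqP T0) invr0 mul0r.
Qed.

End avg_order.

Lemma card_signs_gt0 (I : finType) : (0 < #|{ffun I -> bool}|)%N.
Proof. by rewrite card_ffun card_bool expn_gt0. Qed.

(** * Squared Rademacher norms as averages over sign patterns *)

Section rad.
Context (R : realType) (X : normedModType R[i]).

(** The index type is an arbitrary finite type, so that signs can be attached to pairs and to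
    disjoint sums of indices. *)
Definition radsq (I : finType) (x : I -> X) : R :=
  avg (fun w : {ffun I -> bool} =>
         nrm (\sum_i ((-1) ^+ w i)%:C *: x i) ^+ 2).

Definition rad2sq (I J : finType) (x : I -> J -> X) : R :=
  avg (fun a : {ffun I -> bool} => avg (fun b : {ffun J -> bool} =>
    nrm (\sum_i \sum_j ((-1) ^+ a i * (-1) ^+ b j)%:C *: x i j) ^+ 2)).

Lemma radsq_ge0 (I : finType) (x : I -> X) : 0 <= radsq x.
Proof. by apply: avg_ge0 => w; rewrite sqr_ge0. Qed.

Lemma eq_radsq (I : finType) (x y : I -> X) : x =1 y -> radsq x = radsq y.
Proof.
move=> xy; apply: eq_avg => w; congr (nrm _ ^+ 2).
by apply: eq_bigr => i _; rewrite xy.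
Qed.

Lemma reindex_radsq (I J : finType) (h : J -> I) (x : I -> X) :
  bijective h -> radsq x = radsq (x \o h).
Proof.
move=> bh; have [g hK gK] := bh.
pose H (w : {ffun J -> bool}) := [ffun i => w (g i)].
rewrite /radsq (@reindex_avg _ _ _ H); last first.
  exists (fun w : {ffun I -> bool} => [ffun j => w (h j)]) => w;
    by apply/ffunP => i; rewrite !ffunE ?hK ?gK.
apply: eq_avg => w /=; rewrite (reindex h)/=; last exact: onW_bij.
by congr (nrm _ ^+ 2); apply: eq_bigr => j _; rewrite ffunE hK.
Qed.

Lemma radsqD_le (I : finType) (x y : I -> X) :
  radsq (fun i => x i + y i) <= 2 * (radsq x + radsq y).
Proof.
rewrite /radsq -avgD -avgZ; apply: ler_avg => w.
apply: le_trans (nrm_sqrD_le _ _).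
by rewrite -big_split/=; under [in leRHS]eq_bigr => i _ do rewrite -scalerDr.
Qed.

Lemma radsqZ (I : finType) (a : R[i]) (x : I -> X) :
  radsq (fun i => a *: x i) = nrm (a : R[i]^o) ^+ 2 * radsq x.
Proof.
rewrite /radsq -avgZ; apply: eq_avg => w.
rewrite -exprMn -nrmZ scaler_sumr; congr (nrm _ ^+ 2).
by apply: eq_bigr => i _; rewrite !scalerA mulrC.
Qed.

(** The squared norm is convex, so [radsq] of a mean is at most the mean of the [radsq]. *)
Lemma radsq_avg_le (I S : finType) (x : S -> I -> X) (D : R) : 0 <= D ->
  (forall s, radsq (x s) <= D) ->
  radsq (fun i => (#|S|%:R^-1)%:C *: \sum_s x s i) <= D.
Proof.
move=> D0 xD.
suff h : radsq (fun i => (#|S|%:R^-1)%:C *: \sum_s x s i) <=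
         avg (fun s => radsq (x s)).
  by apply: le_trans h _; exact: avg_le.
rewrite /radsq exchange_avg; apply: ler_avg => w.
have -> : \sum_i ((-1) ^+ w i)%:C *: ((#|S|%:R^-1)%:C *: \sum_s x s i) =
   \sum_s (#|S|%:R^-1 : R)%:C *: \sum_i ((-1) ^+ w i)%:C *: x s i.
  rewrite -scaler_sumr exchange_big/= scaler_sumr; apply: eq_bigr => i _.
  by rewrite -scaler_sumr !scalerA mulrC.
apply: le_trans (nrm_sum_sqr_le _ _) _; first by move=> s; rewrite invr_ge0.
rewrite sumr_const -mulr_sumr /avg mulrA ler_wpM2r//.
  by rewrite sumr_ge0// => s _; rewrite sqr_ge0.
have [->|S0] := posnP #|S|; first by rewrite mulr0n mul0r invr0.
by rewrite -[_ *+ _]mulr_natr mulVf ?mul1r// pnatr_eq0 -lt0n.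
Qed.

End rad.

(** * Rademacher sums as finite averages *)

Section rademacher_integral.
Context d (Omega : measurableType d) (R : realType) (P : probability Omega R).
Variable eps : nat -> {RV P >-> R}.

(* The norm is the infimum of countably many measurable functions: by the
   Lipschitz property it suffices to test rational coefficients. *)
Lemma measurable_nrm_sum (X : normedModType R[i]) n (x : 'I_n -> X) :
  measurable_fun [set: Omega] (fun w => nrm (\sum_(i < n) (eps i w)%:C *: x i)).
Proof.
pose phi (c : 'I_n -> R) := nrm (\sum_(i < n) (c i)%:C *: x i).
have lip (b c : 'I_n -> R) : phi b <= phi c + \sum_i `|b i - c i| * nrm (x i).
  have -> : phi b = nrm (\sum_(i < n) (c i)%:C *: x i +
                         \sum_(i < n) (b i - c i)%:C *: x i).
    rewrite -big_split/=; congr nrm; apply: eq_bigr => i _.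
    by rewrite -scalerDl -rmorphD/= addrC subrK.
  apply: le_trans (ler_nrmD _ _) _; rewrite lerD2l.
  apply: le_trans (ler_nrm_sum _ _ _) _; apply: ler_sum => i _.
  by rewrite nrmZR.
pose psi (q : {ffun 'I_n -> rat}) (w : Omega) :=
  phi (fun i => ratr (q i)) + \sum_(i < n) `|eps i w - ratr (q i)| * nrm (x i).
have mpsi q : measurable_fun setT (psi q).
  apply: measurable_funD => //; apply: measurable_sum => i.
  apply: measurable_funM => //.
  apply: measurableT_comp => //.
  exact: measurable_funB.
move=> mD; apply: (measurability _ (RGenInftyO.measurableE R)) => //.
move=> _ [_ [a ->] <-].
rewrite setTI (_ : _ @^-1` _ = \bigcup_(q : {ffun 'I_n -> rat}) (psi q @^-1` `]-oo, a[)).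
  apply: countable_bigcupT_measurable => [|q]; first exact: countableP.
  by rewrite -[X in measurable X]setTI; apply: mpsi.
apply/seteqP; split => w /=; rewrite in_itv/=; last first.
  move=> [q _ /=]; rewrite in_itv/=; apply: le_lt_trans.
  exact: (lip (fun i => eps i w)).
move=> wa.
(* Two errors occur, one from the Lipschitz bound and one from the sum in [psi], each at most
   [t * \sum_i nrm (x i)]. Together they are less than [t * L], the gap below [a]. *)
pose L := 1 + 2 * \sum_i nrm (x i).
have L0 : 0 < L by rewrite ltr_pwDl// mulr_ge0// sumr_ge0// => i _; exact: nrm_ge0.
pose t := (a - phi (fun i => eps i w)) / L.
have t0 : 0 < t by rewrite divr_gt0// subr_gt0.
have qP i : {q : rat | `|eps i w - ratr q| < t}.
  apply: cid; have [q] := @rat_in_itvoo R (eps i w - t) (eps i w + t) ltac:(lra).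
  by rewrite in_itv/= => /andP[h1 h2]; exists q; rewrite ltr_norml; apply/andP; split; lra.
exists [ffun i : 'I_n => sval (qP i)] => //=; rewrite in_itv/= /psi.
have Sle : \sum_(i < n) `|eps i w - ratr ([ffun i : 'I_n => sval (qP i)] i)| * nrm (x i) <=
           t * \sum_i nrm (x i).
  rewrite mulr_sumr; apply: ler_sum => i _; rewrite ffunE ler_wpM2r ?nrm_ge0//.
  exact: ltW (svalP (qP i)).
have := lip (fun i => ratr ([ffun i : 'I_n => sval (qP i)] i)) (fun i => eps i w).
under eq_bigr => i _ do rewrite distrC.
have : t * L = a - phi (fun i => eps i w) by rewrite divfK// gt_eqF.
rewrite /L /phi /= => tL h; move: h Sle tL.
set u := nrm _; set S := \sum_i _ ; set Y := nrm _; set Z := \sum_i _.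
move=> ? ? ?; lra.
Qed.


Hypothesis heps : rademacher_sequence eps.

Definition sign_event n (s : {ffun 'I_n -> bool}) : set Omega :=
  [set w | forall i : 'I_n, eps i w = (-1) ^+ s i].

(** Independence is stated for events indexed by [nat], so the pattern is extended by an arbitrary
    value beyond [n]. *)
Let sgn n (s : {ffun 'I_n -> bool}) (k : nat) : bool :=
  if insub k is Some i then s i else false.

Let A n (s : {ffun 'I_n -> bool}) (k : nat) : set R := [set (-1) ^+ sgn s k].

Let sign_eventE n (s : {ffun 'I_n -> bool}) :
  sign_event s = \bigcap_(k in [set` [fset k in iota 0 n]%fset]) eps k @^-1` A s k.
Proof.
apply/seteqP; split => w /=.
  move=> h k /=; rewrite !inE mem_iota add0n => /= kn.
  by rewrite /A /sgn /= insubT/= (h (Ordinal kn)).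
move=> h i; have := h i; rewrite /= !inE mem_iota add0n/= ltn_ord => /(_ isT).
rewrite /A /sgn (insubT (fun k => k < n)%N (ltn_ord i))/= => ->.
by congr ((-1) ^+ s _); exact/val_inj.
Qed.

Lemma measurable_sign_event n (s : {ffun 'I_n -> bool}) :
  measurable (sign_event s).
Proof.
rewrite sign_eventE; apply: fin_bigcap_measurable => [|k _]; first exact: finite_fset.
by rewrite -[X in measurable X]setTI; apply: measurable_funP => //; exact: measurable_set1.
Qed.

Lemma probability_sign_event n (s : {ffun 'I_n -> bool}) :
  P (sign_event s) = ((2^-1) ^+ n)%:E.
Proof.
rewrite sign_eventE heps.1; last by move=> k; exact: measurable_set1.
rewrite (eq_bigr (fun=> (2^-1)%:E)); last first.
  move=> k _; have [h1 h2] := heps.2 k.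
  by rewrite /A; case: (sgn s k); rewrite ?expr0 ?expr1; [exact: h2|exact: h1].
rewrite prodEFin; congr EFin.
rewrite big_const_seq iter_mulr_1 count_predT; congr (_ ^+ _).
by rewrite card_fseq undup_id ?size_iota// iota_uniq.
Qed.

(** Almost surely the first [n] variables take the values 1 and -1, so [f] agrees almost everywhere
    with the simple function [g], constant on sign events of mass [2^-n]. *)
Lemma integral_signs n (f : Omega -> R) (F : {ffun 'I_n -> bool} -> R) :
  measurable_fun setT f -> (forall w, 0 <= f w) ->
  (forall s w, sign_event s w -> f w = F s) ->
  \int[P]_w f w = avg F.
Proof.
move=> mf f0 fF.
(* A sign event has positive mass, hence contains a point, at which [f] takes the value [F s]. *)
have F0 s : 0 <= F s.
  have [e|/set0P[w ws]] := eqVneq (sign_event s) set0; last by rewrite -(fF s w).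
  have := probability_sign_event s; rewrite e measure0 => -[] /esym/eqP.
  by rewrite expf_eq0 invr_eq0 pnatr_eq0 andbF.
pose g w : R := \sum_s F s * \1_(sign_event s) w.
have mg : measurable_fun setT g.
  apply: measurable_sum => s; apply: measurable_funM => //.
  by apply: measurable_indic; exact: measurable_sign_event.
rewrite /Rintegral (_ : (\int[P]_w (f w)%:E = \int[P]_w (g w)%:E)%E); last first.
  apply: ge0_ae_eq_integral => //.
  - exact/measurable_EFinP.
  - exact/measurable_EFinP.
  - by move=> w _; rewrite lee_fin.
  - by move=> w _; rewrite lee_fin sumr_ge0// => s _; rewrite mulr_ge0.
  (* The values 1 and -1 are disjoint events of mass 1/2 each, so the complement has mass 0. *)
  have : \forall w \ae P, forall k, eps k w = 1 \/ eps k w = -1.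
    apply: ae_foralln => k.
    exists (~` (eps k @^-1` [set 1] `|` eps k @^-1` [set -1])).
    have m1 (a : R) : measurable (eps k @^-1` [set a]).
      rewrite -[X in measurable X]setTI.
      by apply: measurable_funP => //; exact: measurable_set1.
    split; [by apply: measurableC; apply: measurableU| |by move=> w /= ].
    apply: etrans (probability_setC P _) _; first exact: measurableU.
    rewrite measureU//; last first.
      apply/seteqP; split => // w /= [-> /eqP].
      by rewrite -subr_eq0 opprK -(natrD _ 1 1) pnatr_eq0.
    have [h1 h2] := heps.2 k.
    rewrite [X in (1 - (X + _))%E](_ : _ = (2^-1)%:E); last exact: h1.
    rewrite [X in (1 - (_ + X))%E](_ : _ = (2^-1)%:E); last exact: h2.
    by rewrite -!EFinD; congr EFin; field.
  apply: filterS => w hw _ /=; congr EFin.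
  pose s := [ffun i : 'I_n => eps i w == -1].
  have ws : sign_event s w.
    move=> i; rewrite ffunE; case: eqVneq => [->|]; first by rewrite expr1.
    by have [->|->] := hw i; rewrite ?eqxx ?expr0.
  rewrite (fF s w ws) /g (bigD1 s)//= indicE mem_set// mulr1 big1 ?addr0// => t ts.
  rewrite indicE memNset ?mulr0// => wt; move/eqP: ts; apply.
  by apply/ffunP => i; apply/(@signr_inj R); rewrite -(ws i) -(wt i).
under eq_integral => w _ do rewrite /g -sumEFin.
rewrite ge0_integral_sum//.
- rewrite (eq_bigr (fun s => (F s * 2^-1 ^+ n)%:E)) => [|s _]; last first.
    under eq_integral => w _ do rewrite EFinM.
    rewrite ge0_integralZl_EFin//.
    + rewrite integral_indic//; last exact: measurable_sign_event.
      by rewrite setIT EFinM; congr (_ * _)%E; exact: probability_sign_event.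
    + by apply/measurable_EFinP/measurable_indic/measurable_sign_event.
  rewrite sumEFin /= -mulr_suml mulrC /avg card_ffun card_bool card_ord.
  by rewrite natrX exprVn.
- move=> s; apply/measurable_EFinP; apply: measurable_funM => //.
  by apply: measurable_indic; exact: measurable_sign_event.
- by move=> s w _; rewrite lee_fin mulr_ge0.
Qed.

Context (X : normedModType R[i]).

Lemma sqr_Rad_norm n (x : 'I_n -> X) :
  Rad_norm P (\sum_(i < n) tens eps i (x i)) ^+ 2 = radsq x.
Proof.
rewrite /Rad_norm /L2norm sqr_sqrtr; last first.
  by apply: Rintegral_ge0 => w _; rewrite sqr_ge0.
apply: integral_signs => [|w|s w ws]; last 2 first.
- by rewrite sqr_ge0.
- by rewrite fct_sumE; congr (nrm _ ^+ 2); apply: eq_bigr => i _; rewrite /tens ws.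
under eq_fun do rewrite fct_sumE.
by apply: measurable_funX; exact: measurable_nrm_sum.
Qed.

Lemma sqr_RadRad_norm m n (x : 'I_m -> 'I_n -> X) :
  RadRad_norm P (\sum_(i < m) \sum_(j < n) tens eps i (tens eps j (x i j))) ^+ 2
  = rad2sq x.
Proof.
rewrite /RadRad_norm /L2norm sqr_sqrtr; last first.
  by apply: Rintegral_ge0 => w _; rewrite sqr_ge0.
(* For a fixed outer point [w], the inner function is itself a Rademacher sum, with coefficients
   depending on [w]. *)
have E w : Rad_norm P ((\sum_(i < m) \sum_(j < n) tens eps i (tens eps j (x i j))) w) ^+ 2
   = avg (fun b : {ffun 'I_n -> bool} => nrm (\sum_(i < m) (eps i w)%:C *: \sum_(j < n) ((-1) ^+ b j)%:C *: x i j) ^+ 2).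
  rewrite (_ : _ w = \sum_(j < n) tens eps j (\sum_(i < m) (eps i w)%:C *: x i j)).
    rewrite sqr_Rad_norm; apply: eq_avg => b; congr (nrm _ ^+ 2).
    under eq_bigr => j _ do rewrite scaler_sumr.
    rewrite exchange_big/=; apply: eq_bigr => i _; rewrite scaler_sumr.
    by apply: eq_bigr => j _; rewrite !scalerA mulrC.
  apply/funext => v; rewrite !fct_sumE.
  under eq_bigr => i _ do rewrite !fct_sumE.
  rewrite exchange_big/=; apply: eq_bigr => j _.
  rewrite /tens scaler_sumr; apply: eq_bigr => i _.
  transitivity ((eps i w)%:C *: ((eps j v)%:C *: x i j)); first by [].
  by rewrite !scalerA mulrC.
apply: integral_signs => [|w|s w ws]; last 2 first.
- by rewrite sqr_ge0.
- rewrite E; apply: eq_avg => b; congr (nrm _ ^+ 2).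
  apply: eq_bigr => i _; rewrite ws scaler_sumr; apply: eq_bigr => j _.
  by rewrite scalerA -rmorphM.
under eq_fun do rewrite E.
apply: measurable_funM => //; apply: measurable_sum => b.
by apply: measurable_funX; exact: measurable_nrm_sum.
Qed.

End rademacher_integral.

(** * Property (alpha) *)

Section sign_moments.
Context (R : realFieldType) (I : finType).

Lemma avg_sign_mul (i j : I) :
  avg (fun a : {ffun I -> bool} => (-1) ^+ a i * (-1) ^+ a j : R) = (i == j)%:R.
Proof.
have [->|ij] := eqVneq i j.
  under eq_avg => a do rewrite -signr_addb addbb expr0.
  by rewrite avg_cst// card_signs_gt0.
(* Flipping the sign at [i] permutes the patterns and negates the product, so the average equals its
   own negative. *)
pose h (a : {ffun I -> bool}) := [ffun k => (k == i) (+) a k].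
have hK : involutive h.
  by move=> a; apply/ffunP => k; rewrite !ffunE addbA addbb.
set f := fun a => _; have : avg f = -1 * avg f.
  rewrite -avgZ (reindex_avg (h := h)); last by exists h.
  apply: eq_avg => a; rewrite /f /= !ffunE eqxx (eq_sym j) (negbTE ij)/=.
  by rewrite signrN mulNr mulN1r.
by rewrite mulN1r => /eqP; rewrite -addr_eq0 -mulr2n mulrn_eq0/= => /eqP.
Qed.

Lemma avg_sqr_sum_sign :
  avg (fun a : {ffun I -> bool} => (\sum_i (-1) ^+ a i : R) ^+ 2) = #|I|%:R.
Proof.
under eq_avg => a do rewrite expr2 big_distrlr/=.
rewrite avg_sum; under eq_bigr => i _ do
  (rewrite avg_sum; under eq_bigr => j _ do rewrite avg_sign_mul).
rewrite -sum1_card natr_sum; apply: eq_bigr => i _.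
by rewrite (bigD1 i)//= eqxx big1 ?addr0// => j; rewrite eq_sym => /negbTE ->.
Qed.

End sign_moments.

(** * Double Rademacher sums and decoupling *)

Section rad2.
Context (R : realType) (X : normedModType R[i]).

Lemma rad2sqE (I J : finType) (x : I -> J -> X) :
  rad2sq x = avg (fun a : {ffun I -> bool} =>
    radsq (fun j => \sum_i ((-1) ^+ a i)%:C *: x i j)).
Proof.
apply: eq_avg => a; apply: eq_avg => b; congr (nrm _ ^+ 2).
rewrite exchange_big/=; apply: eq_bigr => j _; rewrite scaler_sumr.
by apply: eq_bigr => i _; rewrite scalerA -rmorphM/= mulrC.
Qed.

Lemma rad2sqC (I J : finType) (x : I -> J -> X) :
  rad2sq x = rad2sq (fun j i => x i j).
Proof.
rewrite /rad2sq exchange_avg; apply: eq_avg => b; apply: eq_avg => a.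
congr (nrm _ ^+ 2); rewrite exchange_big/=; apply: eq_bigr => j _.
by apply: eq_bigr => i _; rewrite mulrC.
Qed.

Lemma reindex_rad2sq (I I' J J' : finType) (f : I' -> I) (g : J' -> J)
    (x : I -> J -> X) : bijective f -> bijective g ->
  rad2sq x = rad2sq (fun i j => x (f i) (g j)).
Proof.
have H (A B B' : finType) (h : B' -> B) (y : A -> B -> X) : bijective h ->
    rad2sq y = rad2sq (fun i j => y i (h j)).
  move=> bh; rewrite !rad2sqE; apply: eq_avg => a.
  exact: reindex_radsq.
move=> bf bg; rewrite (H _ _ _ _ _ bg) rad2sqC (H _ _ _ _ _ bf) rad2sqC.
by [].
Qed.

(* Property (alpha) is used for unimodular multipliers equal to 1 or -1 only. *)
Definition sign_alpha (D : R) : Prop :=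
  forall (I J : finType) (x : I -> J -> X) (t : I * J -> bool),
    rad2sq (fun i j => ((-1) ^+ t (i, j))%:C *: x i j) <= D * rad2sq x.

(** The constant is squared because [rad2sq] is a squared norm; enumerations replace the finite
    types by ordinals. *)
Lemma property_alpha_sign d (Omega : measurableType d) (P : probability Omega R)
    (eps : nat -> {RV P >-> R}) : rademacher_sequence eps ->
  property_alpha eps X -> exists2 D : R, 0 <= D & sign_alpha D.
Proof.
move=> heps [C C1 hC]; exists (C ^+ 2); first exact: sqr_ge0.
move=> I J x t; rewrite (reindex_rad2sq _ (@enum_val_bij I) (@enum_val_bij J)).
rewrite [in leRHS](reindex_rad2sq _ (@enum_val_bij I) (@enum_val_bij J)).
rewrite -!(sqr_RadRad_norm heps) -exprMn ler_sqr ?nnegrE; last 2 first.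
- exact: sqrtr_ge0.
- by rewrite mulr_ge0 ?sqrtr_ge0// (le_trans ler01).
apply: le_trans (hC _ _ _ (fun i j => ((-1) ^+ t (enum_val i, enum_val j))%:C)) _.
rewrite -[leRHS]mulr1 -mulrA -[leRHS]mulrA ler_wpM2l ?(le_trans ler01)//.
rewrite mulrC ler_wpM2l ?sqrtr_ge0//.
by apply/bigmax_leP; split => // i _; rewrite nrmR normrX normrN normr1 expr1n.
Qed.

Section decoupling.
Variable D : R.
Hypothesis hD : sign_alpha D.

(** For fixed [a] and [b], the products of the signs [a i], [b j] and [t (i, j)] run once over all
    patterns on [I * J] as [t] does. *)
Lemma avg_rad2sq_signs (I J : finType) (x : I -> J -> X) :
  avg (fun t : {ffun I * J -> bool} =>
    rad2sq (fun i j => ((-1) ^+ t (i, j))%:C *: x i j)) =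
  radsq (fun p : I * J => x p.1 p.2).
Proof.
rewrite /rad2sq exchange_avg (eq_avg (g := fun=> radsq (fun p : I * J => x p.1 p.2))).
  by rewrite avg_cst// card_signs_gt0.
move=> a; rewrite exchange_avg (eq_avg (g := fun=> radsq (fun p : I * J => x p.1 p.2))).
  by rewrite avg_cst// card_signs_gt0.
move=> b.
pose h (t : {ffun I * J -> bool}) := [ffun p => a p.1 (+) b p.2 (+) t p].
have hK : involutive h.
  by move=> t; apply/ffunP => p; rewrite !ffunE addbA addbb.
rewrite /radsq [RHS](reindex_avg (h := h)); last by exists h.
apply: eq_avg => t /=; congr (nrm _ ^+ 2).
rewrite pair_bigA/=; apply: eq_bigr => -[i j] _ /=.
by rewrite scalerA -rmorphM/= ffunE/= !signr_addb.
Qed.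

(** By the averaged identity, it suffices to apply [sign_alpha] for each [t]. *)
Lemma radsq_decouple_le (I J : finType) (x : I -> J -> X) :
  radsq (fun p : I * J => x p.1 p.2) <= D * rad2sq x.
Proof.
rewrite -avg_rad2sq_signs -[leRHS](avg_cst (T := {ffun I * J -> bool})); last first.
  exact: card_signs_gt0.
by apply: ler_avg => t; exact: hD.
Qed.

Lemma rad2sq_decouple_le (I J : finType) (x : I -> J -> X) :
  rad2sq x <= D * radsq (fun p : I * J => x p.1 p.2).
Proof.
rewrite -avg_rad2sq_signs -[leLHS](avg_cst (T := {ffun I * J -> bool})); last first.
  exact: card_signs_gt0.
rewrite -avgZ; apply: ler_avg => t.
(* Applying the signs [t] to a family already multiplied by them gives back [x]. *)
have := hD (fun i j => ((-1) ^+ t (i, j))%:C *: x i j) t.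
rewrite (_ : (fun i j => _ *: (_ *: _)) = x)//.
apply/funext => i; apply/funext => j.
by rewrite scalerA -rmorphM/= -signr_addb addbb expr0 scale1r.
Qed.

Hypothesis D0 : 0 <= D.

(* N^{-1/2} (eps_{1j} + ... + eps_{Nj}) behaves like a Gaussian for large N; the
   bound is uniform in N because N^{-1/2} (eps_1 + ... + eps_N) has unit variance. *)
Lemma radsq_spread_le (J : finType) (x : J -> X) N : (0 < N)%N ->
  radsq (fun p : 'I_N * J => ((Num.sqrt N%:R)^-1)%:C *: x p.2) <= D * radsq x.
Proof.
move=> N0; apply: le_trans (radsq_decouple_le (fun (_ : 'I_N) j => _ *: x j)) _.
rewrite ler_wpM2l// rad2sqE.
under eq_avg => a.
  under eq_radsq => j do rewrite -scaler_suml.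
  rewrite -rmorph_sum/= .
  under eq_radsq => j do rewrite scalerA -rmorphM/=.
  rewrite radsqZ nrmR real_normK ?num_real// mulrC exprMn mulrCA mulrC.
  over.
rewrite avgZ avg_sqr_sum_sign card_ord exprVn sqr_sqrtr// -mulrA mulVf ?mulr1//.
by rewrite pnatr_eq0 -lt0n.
Qed.

End decoupling.

End rad2.

(** * Riesz products *)

Section trigonometric_estimates.
Context (R : realType).
Implicit Types a x y : R.

Lemma cos_halfE x : 1 - cos x = 2 * sin (x / 2) ^+ 2.
Proof.
have {1}-> : x = (x / 2) *+ 2 by rewrite mulr2n; lra.
rewrite cos_mulr2n; have := cos2Dsin2 (x / 2); set c := cos _; set s := sin _.
by rewrite -mulr_natl; lra.
Qed.

Lemma ler_norm_sin x : `|sin x| <= `|x|.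
Proof.
wlog x0 : x / 0 <= x.
  move=> h; have [/h//|/ltW x0] := lerP 0 x.
  by rewrite -normrN -sinN -[in leRHS]normrN h ?oppr_ge0.
have [c _] := @MVT_segment R (@sin R) (@cos R) 0 x x0 (fun y _ => is_derive_sin y)
  (continuous_subspaceT (@continuous_sin R)).
rewrite sin0 !subr0 => ->; rewrite normrM ler_piMl//; exact: cos_max.
Qed.

Lemma one_sub_cos_ge0 x : 0 <= 1 - cos x.
Proof. by rewrite subr_ge0 cos_le1. Qed.

Lemma one_sub_cos_le x : 1 - cos x <= x ^+ 2 / 2.
Proof.
rewrite cos_halfE; have : sin (x / 2) ^+ 2 <= (x / 2) ^+ 2.
  rewrite -[leLHS]real_normK ?num_real// -[leRHS]real_normK ?num_real//.
  by rewrite ler_sqr ?nnegrE// ler_norm_sin.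
rewrite [(x / 2) ^+ 2]exprMn exprVn; set s := sin _ ^+ 2; set t := x ^+ 2; lra.
Qed.

Lemma sin_sub_le x : `|sin x - x| <= `|x| ^+ 3.
Proof.
wlog x0 : x / 0 <= x.
  move=> h; have [/h//|/ltW x0] := lerP 0 x.
  have := h (- x); rewrite sinN normrN -opprD normrN; apply.
  by rewrite oppr_ge0.
have hd y : y \in `]0, x[ -> is_derive y 1 (fun y => sin y - y) (cos y - 1).
  by move=> _; apply: is_deriveB.
have [c] := @MVT_segment R (fun y => sin y - y) (fun y => cos y - 1) 0 x x0 hd
  (continuous_subspaceT (fun y => cvgB (@continuous_sin R y) (@cvg_id _ (nbhs y)))).
rewrite in_itv/= => /andP[c0 cx]; rewrite sin0 !subr0 => ->.
rewrite normrM exprSr ler_wpM2r// distrC ger0_norm ?one_sub_cos_ge0//.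
apply: le_trans (one_sub_cos_le _) _; rewrite (ger0_norm x0).
have : c ^+ 2 <= x ^+ 2 by rewrite ler_sqr ?nnegrE.
have := sqr_ge0 c; set u := c ^+ 2; set v := x ^+ 2; lra.
Qed.

(** Both functions are within [x^4 / 4] of [1 - x^2 / 2]. *)
Lemma cos_sub_expR_le x : `|cos x - expR (- (x ^+ 2 / 2))| <= x ^+ 4.
Proof.
have h1 : `|cos x - (1 - x ^+ 2 / 2)| <= x ^+ 4 / 4.
  (* The half-angle formula turns the error into a difference of squares, one factor of which is
     cubic in [x] and the other linear. *)
  have -> : cos x - (1 - x ^+ 2 / 2) =
      - (2 * ((sin (x / 2) - x / 2) * (sin (x / 2) + x / 2))).
    have := cos_halfE x; set s := sin _ => h.
    have -> : cos x = 1 - 2 * s ^+ 2 by lra.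
    by field.
  rewrite normrN normrM (@ger0_norm _ 2)// normrM.
  have h2 := sin_sub_le (x / 2).
  have h3 : `|sin (x / 2) + x / 2| <= 2 * `|x / 2|.
    apply: le_trans (ler_normD _ _) _; have := ler_norm_sin (x / 2); lra.
  have := ler_pM (normr_ge0 _) (normr_ge0 _) h2 h3.
  have -> : `|x / 2| ^+ 3 * (2 * `|x / 2|) = x ^+ 4 / 8.
    have -> : x ^+ 4 = `|x| ^+ 4 by rewrite -normrX ger0_norm// exprn_even_ge0.
    by rewrite normrM (@ger0_norm _ (2^-1)) ?invr_ge0//; field.
  lra.
set y := x ^+ 2 / 2.
have y0 : 0 <= y by rewrite divr_ge0 ?sqr_ge0.
(* From [1 - y <= expR (- y) <= 1 / (1 + y) <= 1 - y + y^2]. *)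
have h4 : `|1 - y - expR (- y)| <= y ^+ 2.
  rewrite distrC ger0_norm; last by rewrite subr_ge0 expR_ge1Dx.
  have h : expR (- y) <= (1 + y)^-1.
    by rewrite expRN lef_pV2 ?posrE ?expR_gt0 ?expR_ge1Dx//; lra.
  have : (1 + y)^-1 <= 1 - y + y ^+ 2.
    rewrite -[leLHS]div1r ler_pdivrMr; last lra.
    have : 0 <= y ^+ 3 by rewrite exprn_ge0.
    by nra.
  lra.
have -> : x ^+ 4 = 4 * y ^+ 2 by rewrite /y; field.
have -> : cos x - expR (- y) = (cos x - (1 - y)) + (1 - y - expR (- y)) by ring.
apply: le_trans (ler_normD _ _) _.
move: h1; have -> : x ^+ 4 / 4 = y ^+ 2 by rewrite /y; field.
rewrite -/y; have := sqr_ge0 y; lra.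
Qed.

Lemma normrB_exp_le x y n : `|x| <= 1 -> `|y| <= 1 ->
  `|x ^+ n - y ^+ n| <= n%:R * `|x - y|.
Proof.
move=> x1 y1; elim: n => [|n IH]; first by rewrite !expr0 subrr normr0 mul0r.
have -> : x ^+ n.+1 - y ^+ n.+1 = x * (x ^+ n - y ^+ n) + (x - y) * y ^+ n.
  by rewrite !exprS; ring.
apply: le_trans (ler_normD _ _) _; rewrite -natr1 [leRHS]mulrDl mul1r; apply: lerD.
  by rewrite normrM; apply: le_trans IH; rewrite ler_piMl.
by rewrite normrM ler_piMr// normrX exprn_ile1.
Qed.

Lemma cvg_bounded_harmonic (f : nat -> R) (l c : R) :
  (forall n, `|f n - l| <= c * n.+1%:R^-1) -> f @ \oo --> l.
Proof.
move=> h; apply: (@squeeze_cvgr _ _ _ _ (fun n => l - c * n.+1%:R^-1)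
    (fun n => l + c * n.+1%:R^-1)).
- by apply: nearW => n; rewrite -ler_distl.
- rewrite -[X in _ --> X]subr0 -[X in _ --> _ - X](mulr0 c).
  apply: cvgB; first exact: cvg_cst.
  by apply: cvgM; [exact: cvg_cst|exact: cvg_harmonic].
- rewrite -[X in _ --> X]addr0 -[X in _ --> _ + X](mulr0 c).
  apply: cvgD; first exact: cvg_cst.
  by apply: cvgM; [exact: cvg_cst|exact: cvg_harmonic].
Qed.

Let sqrtS_gt0 n : 0 < Num.sqrt n.+1%:R :> R.
Proof. by rewrite sqrtr_gt0. Qed.

Let sqrtS2 n : Num.sqrt n.+1%:R ^+ 2 = n.+1%:R :> R.
Proof. by rewrite sqr_sqrtr. Qed.

(** The central limit theorem for signs, through characteristic functions: each of the [N] factors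
    has error at most [a^4 / N^2], so the product has error at most [a^4 / N]. *)
Lemma cvg_cos_pow a :
  (fun n => cos (a / Num.sqrt n.+1%:R) ^+ n.+1) @ \oo --> expR (- (a ^+ 2 / 2)).
Proof.
apply: (@cvg_bounded_harmonic _ _ (a ^+ 4)) => n.
set N : R := n.+1%:R; set x := a / Num.sqrt N.
have N0 : N != 0 by rewrite pnatr_eq0.
have -> : expR (- (a ^+ 2 / 2)) = expR (- (x ^+ 2 / 2)) ^+ n.+1.
  rewrite -expRM_natr; congr expR; rewrite /x exprMn exprVn sqrtS2 -/N; field.
  by rewrite nat1r.
apply: le_trans (normrB_exp_le _ (cos_max _) _) _.
  by rewrite ger0_norm ?expR_ge0// -expR0 ler_expR oppr_le0 divr_ge0// sqr_ge0.
have -> : a ^+ 4 * N^-1 = N * x ^+ 4.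
  have h : Num.sqrt N ^+ 4 = N ^+ 2 by rewrite (exprM (Num.sqrt N) 2 2) sqrtS2.
  by rewrite /x exprMn exprVn h; field; rewrite nat1r.
by rewrite ler_wpM2l// cos_sub_expR_le.
Qed.

Lemma cvg_sqrt_sin a :
  (fun n => Num.sqrt n.+1%:R * sin (a / Num.sqrt n.+1%:R)) @ \oo --> a.
Proof.
apply: (@cvg_bounded_harmonic _ _ (`|a| ^+ 3)) => n.
set s := Num.sqrt _; have s0 : 0 < s by exact: sqrtS_gt0.
rewrite -sqrtS2 -/s.
have -> : s * sin (a / s) - a = s * (sin (a / s) - a / s).
  by field; rewrite gt_eqF.
rewrite normrM (gtr0_norm s0).
have -> : `|a| ^+ 3 * (s ^+ 2)^-1 = s * `|a / s| ^+ 3.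
  by rewrite normrM normfV (gtr0_norm s0); field; rewrite gt_eqF//.
by rewrite ler_wpM2l ?sin_sub_le// ltW.
Qed.

Lemma cvg_one_sub_cos a :
  (fun n => 1 - cos (a / Num.sqrt n.+1%:R)) @ \oo --> (0 : R).
Proof.
apply: (@cvg_bounded_harmonic _ _ (a ^+ 2)) => n.
rewrite subr0 ger0_norm ?one_sub_cos_ge0//.
apply: le_trans (one_sub_cos_le _) _.
rewrite exprMn exprVn sqrtS2 ler_piMr//; last by lra.
by rewrite divr_ge0 ?sqr_ge0.
Qed.

End trigonometric_estimates.

(** * Characteristic functions of sign sums *)

Section characteristic_functions.
Context (R : realType).

Definition cis (x : R) : R[i] := cos x +i* sin x.

Lemma cis0 : cis 0 = 1.
Proof. by rewrite /cis cos0 sin0. Qed.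

Lemma cisD x y : cis (x + y) = cis x * cis y.
Proof.
rewrite /cis cosD sinD; apply/eqP.
by rewrite eq_complex/= addrC [in X in _ && X]addrC !eqxx.
Qed.

Lemma cis_sum (I : finType) (f : I -> R) : cis (\sum_i f i) = \prod_i cis (f i).
Proof. exact: (big_morph cis cisD cis0). Qed.

Lemma cos_cis x : (cos x)%:C = (cis x + cis (- x)) / 2.
Proof.
rewrite (_ : cis x + _ = (cos x)%:C * 2) ?mulfK ?pnatr_eq0//.
by rewrite mulr_natr mulr2n /cis cosN sinN; apply/eqP; rewrite eq_complex/= subrr addr0 !eqxx.
Qed.

Lemma sin_cis x : 'i * (sin x)%:C = (cis x - cis (- x)) / 2.
Proof.
rewrite (_ : cis x - _ = 'i * (sin x)%:C * 2) ?mulfK ?pnatr_eq0//.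
rewrite mulr_natr mulr2n /cis cosN sinN; apply/eqP; rewrite eq_complex/=.
by apply/andP; split; apply/eqP; ring.
Qed.

Lemma avg_bool (F : fieldType) (f : bool -> F) : avg f = (f true + f false) / 2.
Proof. by rewrite /avg card_bool big_bool mulrC. Qed.

Variables (Q : finType) (r : Q -> R).

Lemma avg_cis :
  avg (fun w : {ffun Q -> bool} => cis (\sum_q r q * (-1) ^+ w q)) =
  (\prod_q cos (r q))%:C.
Proof.
under eq_avg => w do rewrite cis_sum.
rewrite (avg_prod (fun q b => cis (r q * (-1) ^+ b))) rmorph_prod.
apply: eq_bigr => q _.
by rewrite avg_bool/= cos_cis expr0 expr1 mulr1 mulrN1 addrC.
Qed.

(** By independence only the factor at [q0] differs from [avg_cis]: the sign turns its cosine into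
    ['i] times a sine. *)
Lemma avg_sign_cis (q0 : Q) :
  avg (fun w : {ffun Q -> bool} =>
    ((-1) ^+ w q0)%:C * cis (\sum_q r q * (-1) ^+ w q)) =
  'i * (sin (r q0) * \prod_(q | q != q0) cos (r q))%:C.
Proof.
pose f q b : R[i] := (if q == q0 then ((-1) ^+ b)%:C else 1) * cis (r q * (-1) ^+ b).
under eq_avg => w.
  rewrite cis_sum (_ : _ * _ = \prod_q f q (w q)).
    over.
  rewrite /f big_split/= [X in _ = X * _](bigD1 q0)//= eqxx.
  rewrite [X in _ = _ * X * _]big1 ?mulr1//.
  by move=> q /negbTE ->.
rewrite (avg_prod f) (bigD1 q0)//= rmorphM rmorph_prod/= mulrA; congr (_ * _).
  rewrite avg_bool /f eqxx sin_cis expr0 expr1 mulr1 mulrN1 rmorphN rmorph1.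
  by rewrite mulN1r mul1r addrC.
apply: eq_bigr => q /negbTE qq0.
by rewrite avg_bool /f qq0/= cos_cis expr0 expr1 mulr1 mulrN1 !mul1r addrC.
Qed.

End characteristic_functions.

(** * Riesz products and their expansion into exponentials *)

Section riesz_expansion.
Context (R : realType) (I : finType).

(* [None] stands for the frequency 0. *)
Definition freq (o : option bool) : R := if o is Some b then (-1) ^+ b else 0.

(** The coefficients of [1 + d * sin z] in the exponentials of frequencies 0, 1 and -1, since
    [sin z] is [- 'i / 2] times [cis z - cis (- z)]. *)
Definition freq_coef (d : R) (o : option bool) : R[i] :=
  if o is Some b then - 'i * (d * (-1) ^+ b / 2)%:C else 1.

Definition riesz (s : {ffun I -> bool}) (z : I -> R) : R :=
  \prod_p (1 + (-1) ^+ s p * sin (z p)).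

Definition riesz_coef (s : {ffun I -> bool}) (t : {ffun I -> option bool}) : R[i] :=
  \prod_p freq_coef ((-1) ^+ s p) (t p).

Lemma big_option_bool (V : nmodType) (f : option bool -> V) :
  \sum_o f o = f None + (f (Some true) + f (Some false)).
Proof.
rewrite (bigD1 None)//= (bigD1 (Some true))//= (bigD1 (Some false))//= big1 ?addr0//.
by case=> [[]|].
Qed.

Lemma rieszE s z : (riesz s z)%:C =
  \sum_t riesz_coef s t * cis (\sum_p freq (t p) * z p).
Proof.
under eq_bigr => t _ do rewrite cis_sum -big_split/=.
rewrite -(bigA_distr_bigA (fun p o => freq_coef ((-1) ^+ s p) o * cis (freq o * z p))).
rewrite /riesz rmorph_prod; apply: eq_bigr => p _.
rewrite big_option_bool /freq_coef /freq mul0r cis0 mulr1 expr0 expr1 mul1r mulN1r.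
rewrite rmorphD rmorph1; congr (_ + _) => /=.
rewrite /cis cosN sinN; apply/eqP; rewrite eq_complex/=.
by apply/andP; split; apply/eqP; field.
Qed.

Lemma riesz_ge0 s z : 0 <= riesz s z.
Proof.
apply: prodr_ge0 => p _; have := sin_geN1 (z p); have := sin_le1 (z p).
by case: (s p); rewrite ?expr0 ?expr1; lra.
Qed.

Lemma avg_riesz z : avg (fun s => riesz s z) = 1.
Proof.
rewrite (avg_prod (fun p b => 1 + (-1) ^+ b * sin (z p))) big1// => p _.
by rewrite avg_bool expr0 expr1; field.
Qed.

Let gauss (o : option bool) : R := expR (- (freq o ^+ 2 / 2)).

(** The sum factorises over [p]. As [gauss] is even and the coefficients at 1 and -1 are opposite,
    only frequency 0 survives in each factor. This will be the limiting mean of [riesz]. *)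
Lemma sum_riesz_gauss s :
  \sum_t riesz_coef s t * (\prod_p gauss (t p))%:C = 1.
Proof.
under eq_bigr => t _ do rewrite rmorph_prod -big_split/=.
rewrite -(bigA_distr_bigA (fun p o => freq_coef ((-1) ^+ s p) o * (gauss o)%:C)).
rewrite big1// => p _; rewrite big_option_bool /gauss /freq /freq_coef.
rewrite expr0n mul0r oppr0 expR0 rmorph1 mul1r expr0 expr1 sqrrN.
by apply/eqP; rewrite eq_complex/=; apply/andP; split; apply/eqP; field.
Qed.

(** The sum factorises again. In the factor at [q] the odd weight [freq] makes the frequencies 1 and
    -1 add up instead of cancel; all other factors are 1. *)
Lemma sum_riesz_freq_gauss s (q : I) :
  \sum_t riesz_coef s t * 'i * (freq (t q) * \prod_p gauss (t p))%:C =
  (expR (- (1 / 2)) * (-1) ^+ s q)%:C.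
Proof.
pose F p o : R[i] := freq_coef ((-1) ^+ s p) o * (gauss o)%:C *
   (if p == q then 'i * (freq o)%:C else 1).
rewrite (eq_bigr (fun t : {ffun I -> option bool} => \prod_p F p (t p))); last first.
  move=> t _; rewrite /F !big_split/= [X in _ = _ * X](bigD1 q)//= eqxx.
  rewrite [X in _ = _ * (_ * X)]big1 ?mulr1; last by move=> p /negbTE ->.
  by rewrite rmorphM rmorph_prod/= /riesz_coef; ring.
rewrite -bigA_distr_bigA (bigD1 q)//= [X in _ * X]big1 ?mulr1.
    rewrite big_option_bool /F eqxx /gauss /freq /freq_coef.
  rewrite rmorph0 !mulr0 add0r expr0 expr1 sqrrN expr1n.
  set e := expR _; set d := _ ^+ _.
  by apply/eqP; rewrite eq_complex/=; apply/andP; split; apply/eqP; field.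
move=> p pq; rewrite /F (negbTE pq) big_option_bool /gauss /freq /freq_coef.
rewrite expr0n mul0r oppr0 expR0 rmorph1 mul1r expr0 expr1 sqrrN.
by apply/eqP; rewrite eq_complex/=; apply/andP; split; apply/eqP; field.
Qed.

End riesz_expansion.

Lemma cvg_sumr (R : realType) (T : Type) (F : set_system T) (I : finType)
    (f : T -> I -> R) (l : I -> R) : Filter F ->
  (forall i, (fun n => f n i) @ F --> l i) ->
  (fun n => \sum_i f n i) @ F --> \sum_i l i.
Proof.
move=> FF h; elim: (index_enum I) => [|i s IH].
  by rewrite big_nil; under eq_fun do rewrite big_nil; exact: cvg_cst.
rewrite big_cons; under eq_fun do rewrite big_cons.
exact: cvgD.
Qed.

Lemma cvg_prodr (R : realType) (T : Type) (F : set_system T) (I : finType)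
    (f : T -> I -> R) (l : I -> R) : Filter F ->
  (forall i, (fun n => f n i) @ F --> l i) ->
  (fun n => \prod_i f n i) @ F --> \prod_i l i.
Proof.
move=> FF h; elim: (index_enum I) => [|i s IH].
  by rewrite big_nil; under eq_fun do rewrite big_nil; exact: cvg_cst.
rewrite big_cons; under eq_fun do rewrite big_cons.
exact: cvgM.
Qed.

(** * Limits of the moments of Riesz products *)

Section riesz_asymptotics.
Context (R : realType) (I J : finType) (Z : I -> J -> R).

(** The nearly Gaussian variable [h_j], with [N = n.+1] to avoid division by 0; [spread_mix] below
    is [Z h]. *)
Definition spread n (w : {ffun 'I_n.+1 * J -> bool}) (j : J) : R :=
  (Num.sqrt n.+1%:R)^-1 * \sum_(i < n.+1) (-1) ^+ w (i, j).

Definition spread_mix n (w : {ffun 'I_n.+1 * J -> bool}) (p : I) : R :=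
  \sum_j Z p j * spread w j.

Let a (t : {ffun I -> option bool}) (j : J) : R := \sum_p freq R (t p) * Z p j.

Let r n (t : {ffun I -> option bool}) (q : 'I_n.+1 * J) : R :=
  a t q.2 / Num.sqrt n.+1%:R.

(** [K n t] is the characteristic function of [spread] at [a t]; [G] below is the same product
    without the factor at [q0]. *)
Let K n (t : {ffun I -> option bool}) := \prod_q cos (@r n t q).

Let G n (t : {ffun I -> option bool}) (q0 : 'I_n.+1 * J) := \prod_(q | q != q0) cos (@r n t q).

Let sum_freq_mix n (t : {ffun I -> option bool}) w :
  \sum_p freq R (t p) * @spread_mix n w p = \sum_q @r n t q * (-1) ^+ w q.
Proof.
transitivity (\sum_j a t j * spread w j).
  under eq_bigr => p _ do rewrite mulr_sumr.
  rewrite exchange_big/=; apply: eq_bigr => j _; rewrite mulr_suml.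
  by apply: eq_bigr => p _; rewrite mulrA.
under eq_bigr => j _ do rewrite /spread mulrA mulr_sumr.
by rewrite exchange_big pair_bigA/=; apply: eq_bigr => -[i j].
Qed.

(** The expansion is complex; real parts are taken because the limits are studied in [R]. *)
Let avg_rieszE n s : avg (fun w => riesz s (@spread_mix n w)) =
  \sum_t complex.Re (riesz_coef R s t) * K n t.
Proof.
have : (avg (fun w => riesz s (@spread_mix n w)))%:C =
    \sum_t riesz_coef R s t * (K n t)%:C.
  rewrite [LHS](rmorph_avg (real_complex R)).
  under eq_avg => w do rewrite /= rieszE.
  rewrite avg_sum; apply: eq_bigr => t _.
  by rewrite avgZ; under eq_avg => w do rewrite sum_freq_mix; rewrite avg_cis.
move=> /(congr1 (@complex.Re R)) /= ->; rewrite raddf_sum/=; apply: eq_bigr => t _.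
by case: (riesz_coef R s t) => x y /=; rewrite mulr0 subr0.
Qed.

Let T n (t : {ffun I -> option bool}) j := Num.sqrt n.+1%:R * sin (a t j / Num.sqrt n.+1%:R) *
  (n.+1%:R^-1 * \sum_(i < n.+1) G t (i, j)).

Let avg_cis_spread n (t : {ffun I -> option bool}) j :
  avg (fun w : {ffun 'I_n.+1 * J -> bool} => cis (\sum_q @r n t q * (-1) ^+ w q) * (spread w j)%:C) =
  'i * (T n t j)%:C.
Proof.
under eq_avg => w do rewrite /spread rmorphM rmorph_sum/= mulrCA mulr_sumr.
rewrite avgZ avg_sum.
under eq_bigr => i _.
  under eq_avg => w do rewrite mulrC.
  rewrite avg_sign_cis.
  over.
rewrite -mulr_sumr -rmorph_sum/= mulrCA; congr (_ * _).
rewrite -rmorphM/=; under eq_bigr => i _ do rewrite {1}/r /=.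
rewrite -mulr_sumr; congr (_%:C).
rewrite /T mulrA mulrA; congr (_ * _).
rewrite mulrAC; congr (_ * _).
set x := Num.sqrt _; have x0 : x != 0 by rewrite gt_eqF// sqrtr_gt0.
by rewrite -[n.+1%:R](@sqr_sqrtr _ n.+1%:R)// -/x; field.
Qed.

Let avg_riesz_spreadE n s j :
  avg (fun w => riesz s (@spread_mix n w) * spread w j) =
  \sum_t complex.Re (riesz_coef R s t * 'i) * T n t j.
Proof.
have : (avg (fun w => riesz s (@spread_mix n w) * spread w j))%:C =
    \sum_t riesz_coef R s t * 'i * (T n t j)%:C.
  rewrite [LHS](rmorph_avg (real_complex R)).
  under eq_avg => w do rewrite /= rmorphM/= rieszE mulr_suml.
  rewrite avg_sum; apply: eq_bigr => t _.
  under eq_avg => w do rewrite sum_freq_mix -mulrA.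
  by rewrite avgZ avg_cis_spread mulrA.
move=> /(congr1 (@complex.Re R)) /= ->; rewrite raddf_sum/=; apply: eq_bigr => t _.
by case: (riesz_coef R s t * 'i) => x y /=; rewrite mulr0 subr0.
Qed.

Hypothesis Zortho : forall p q, \sum_j Z p j * Z q j = (p == q)%:R.

Let gauss (o : option bool) : R := expR (- (freq R o ^+ 2 / 2)).

(** The rows of [Z] are orthonormal, so the squares of [a t j] sum over [j] to the sum over [p] of
    the squared frequencies. This is the rotation invariance of the Gaussian limit. *)
Let cvg_K (t : {ffun I -> option bool}) : (fun n => K n t) @ \oo --> \prod_p gauss (t p).
Proof.
have -> : \prod_p gauss (t p) = \prod_j expR (- (a t j ^+ 2 / 2)).
  rewrite -!expR_sum; congr expR; rewrite !sumrN; congr (- _).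
  rewrite -!mulr_suml; congr (_ / _).
  under [RHS]eq_bigr => j _ do rewrite expr2 big_distrlr/=.
  rewrite exchange_big/=; apply: eq_bigr => p _.
  rewrite exchange_big/= (bigD1 p)//= [X in _ + X]big1 ?addr0 => [|q qp].
    under eq_bigr => j _ do rewrite mulrACA.
    by rewrite -mulr_sumr Zortho eqxx mulr1.
  under eq_bigr => j _ do rewrite mulrACA.
  by rewrite -mulr_sumr Zortho eq_sym (negbTE qp) mulr0.
have -> : (fun n => K n t) =
    (fun n => \prod_j cos (a t j / Num.sqrt n.+1%:R) ^+ n.+1).
  apply/funext => n; rewrite /K.
  rewrite -(pair_bigA _ (fun (i : 'I_n.+1) j => cos (r t (i, j))))/= exchange_big/=.
  apply: eq_bigr => j _; rewrite (eq_bigr (fun=> cos (a t j / Num.sqrt n.+1%:R)))//.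
  by rewrite prodr_const card_ord.
by apply: cvg_prodr => j; exact: cvg_cos_pow.
Qed.

Let cvg_T (t : {ffun I -> option bool}) j : (fun n => T n t j) @ \oo --> a t j * \prod_p gauss (t p).
Proof.
apply: cvgM; first exact: cvg_sqrt_sin.
pose d n := (n.+1%:R^-1 * \sum_(i < n.+1) G t (i, j)) - K n t.
have -> : (fun n => n.+1%:R^-1 * \sum_(i < n.+1) G t (i, j)) = K ^~ t \+ d.
  by apply/funext => n; rewrite /d /= addrC subrK.
rewrite -[X in _ --> X]addr0; apply: cvgD; first exact: cvg_K.
(* [G - K] is [G] times [1 - cos], and [G] is at most 1 in absolute value; so omitting one factor
   does not matter in the limit. *)
have dle n : `|d n| <= 1 - cos (a t j / Num.sqrt n.+1%:R).
  have -> : d n = n.+1%:R^-1 * \sum_(i < n.+1) (G t (i, j) - K n t).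
    rewrite sumrB mulrBr /d; congr (_ - _).
    by rewrite sumr_const card_ord -[K _ _ *+ _]mulr_natl mulKf// pnatr_eq0.
  rewrite normrM ger0_norm ?invr_ge0// ler_pdivrMl//.
  apply: le_trans (ler_norm_sum _ _ _) _.
  rewrite [leRHS](_ : _ = \sum_(i < n.+1) (1 - cos (a t j / Num.sqrt n.+1%:R)));
    last by rewrite sumr_const card_ord mulr_natl.
  apply: ler_sum => i _.
  rewrite /K (bigD1 (i, j))//= -/(G t (i, j)) -[X in X - _]mul1r -mulrBl normrM.
  rewrite -[r t (i, j)]/(a t j / Num.sqrt n.+1%:R).
  rewrite ger0_norm ?one_sub_cos_ge0// ler_piMr ?one_sub_cos_ge0//.
  rewrite normr_prod; apply: prodr_ile1 => q _.
  by rewrite normr_ge0 cos_max.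
apply: (@squeeze_cvgr _ _ _ _ (fun n => - (1 - cos (a t j / Num.sqrt n.+1%:R)))
    (fun n => 1 - cos (a t j / Num.sqrt n.+1%:R))).
- by apply: nearW => n; rewrite -ler_norml.
- by rewrite -[X in _ --> X]oppr0; apply: cvgN; exact: cvg_one_sub_cos.
- exact: cvg_one_sub_cos.
Qed.

Lemma cvg_avg_riesz s :
  (fun n => avg (fun w => riesz s (@spread_mix n w))) @ \oo --> (1 : R).
Proof.
under eq_fun do rewrite avg_rieszE.
have -> : 1 = \sum_t complex.Re (riesz_coef R s t) * \prod_p gauss (t p).
  have /(congr1 (@complex.Re R)) := sum_riesz_gauss R s.
  rewrite raddf_sum/= => h; rewrite -[LHS]h; apply: eq_bigr => t _.
  by case: (riesz_coef R s t) => x y /=; rewrite mulr0 subr0.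
by apply: cvg_sumr => t; apply: cvgM; [exact: cvg_cst|exact: cvg_K].
Qed.

Lemma cvg_avg_riesz_spread s j :
  (fun n => avg (fun w => riesz s (@spread_mix n w) * spread w j)) @ \oo -->
  expR (- (1 / 2)) * \sum_p (-1) ^+ s p * Z p j.
Proof.
under eq_fun do rewrite avg_riesz_spreadE.
have -> : expR (- (1 / 2)) * \sum_p (-1) ^+ s p * Z p j =
    \sum_t complex.Re (riesz_coef R s t * 'i) * (a t j * \prod_p gauss (t p)).
  rewrite mulr_sumr; under eq_bigr => p _.
    rewrite mulrA.
    have /(congr1 (@complex.Re R))/= <- := sum_riesz_freq_gauss R s p.
    rewrite raddf_sum/= mulr_suml.
    over.
  rewrite exchange_big/=; apply: eq_bigr => t _.
  rewrite /a mulr_suml mulr_sumr; apply: eq_bigr => p _.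
  case: (riesz_coef R s t * 'i) => x y /=; rewrite mulr0 subr0 /gauss; ring.
by apply: cvg_sumr => t; apply: cvgM; [exact: cvg_cst|exact: cvg_T].
Qed.

End riesz_asymptotics.

(** * Matrices with orthonormal rows *)

Section riesz_bound.
Context (R : realType) (X : normedModType R[i]) (I J : finType).
Variables (Z : I -> J -> R) (x : J -> X) (D : R).
Hypothesis Zortho : forall p q, \sum_j Z p j * Z q j = (p == q)%:R.
Hypothesis xD : forall n,
  radsq (fun p : 'I_n.+1 * J => ((Num.sqrt n.+1%:R)^-1)%:C *: x p.2) <= D.

Let e : R := expR (- (1 / 2)).

Let z n (w : {ffun 'I_n.+1 * J -> bool}) := \sum_j (spread R w j)%:C *: x j.

Let avg_nrm_z n : avg (fun w => nrm (@z n w) ^+ 2) <= D.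
Proof.
apply: le_trans (xD n); rewrite le_eqVlt; apply/orP; left; apply/eqP.
apply: eq_avg => w; congr (nrm _ ^+ 2).
transitivity (\sum_j \sum_i ((-1) ^+ w (i, j))%:C *:
    ((Num.sqrt n.+1%:R)^-1%:C *: x j)); last first.
  by rewrite exchange_big pair_bigA/=; apply: eq_bigr => -[i j].
apply: eq_bigr => j _; rewrite /spread mulr_sumr rmorph_sum scaler_suml.
by apply: eq_bigr => i _; rewrite scalerA -rmorphM/= mulrC.
Qed.

Let rz n s w := riesz s (@spread_mix R I J Z n w).

Let m n s j := avg (fun w => rz s w * @spread R J n w j).

(** Jensen's inequality with the nonnegative weights [rz], normalised by the number of patterns. *)
Let mean_le n s : nrm (\sum_j (m n s j)%:C *: x j) ^+ 2 <=
  avg (fun w => @rz n s w) * avg (fun w => @rz n s w * nrm (@z n w) ^+ 2).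
Proof.
pose c : R := #|{ffun 'I_n.+1 * J -> bool}|%:R^-1.
have -> : \sum_j (m n s j)%:C *: x j = \sum_w (c * @rz n s w)%:C *: z w.
  under [RHS]eq_bigr => w _ do rewrite /z scaler_sumr.
  rewrite exchange_big/=; apply: eq_bigr => j _.
  rewrite /m /avg mulr_sumr rmorph_sum scaler_suml; apply: eq_bigr => w _.
  by rewrite scalerA -rmorphM/= mulrA.
apply: le_trans (nrm_sum_sqr_le _ _) _.
  by move=> w; rewrite mulr_ge0 ?invr_ge0 ?riesz_ge0.
rewrite -mulr_sumr; under [X in _ * X <= _]eq_bigr => w _ do rewrite -mulrA.
by rewrite -mulr_sumr.
Qed.

Lemma radsq_ortho_le :
  radsq (fun p => \sum_j (Z p j)%:C *: x j) <= expR 1 * (4 * D).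
Proof.
pose l (s : {ffun I -> bool}) j := \sum_p (-1) ^+ s p * Z p j.
(* [rho] bounds the error made by replacing the limit [e * l s j] with the moment [m n s j]. *)
pose rho n s := \sum_j `|m n s j - e * l s j| * nrm (x j).
have cvg_rho s : (rho ^~ s) @ \oo --> (0 : R).
  rewrite [X in _ --> X](_ : 0 = \sum_(j : J) 0 * nrm (x j)); last first.
    by rewrite big1// => j _; rewrite mul0r.
  apply: cvg_sumr => j; apply: cvgM; last exact: cvg_cst.
  rewrite -(normr0 R) -(subrr (e * l s j)).
  apply: cvg_norm; apply: cvgB; last exact: cvg_cst.
  exact: cvg_avg_riesz_spread.
have step n (s : {ffun I -> bool}) : e ^+ 2 * nrm (\sum_p ((-1) ^+ s p)%:C *: \sum_j (Z p j)%:C *: x j) ^+ 2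
   <= 2 * (nrm (\sum_j (m n s j)%:C *: x j) ^+ 2 + rho n s ^+ 2).
  have -> : \sum_p ((-1) ^+ s p)%:C *: \sum_j (Z p j)%:C *: x j =
      \sum_j (l s j)%:C *: x j.
    under eq_bigr => p _ do rewrite scaler_sumr.
    rewrite exchange_big/=; apply: eq_bigr => j _.
    rewrite /l rmorph_sum scaler_suml; apply: eq_bigr => p _.
    by rewrite scalerA -rmorphM.
  have e0 : 0 <= e by exact: expR_ge0.
  rewrite -exprMn -[X in X * _](ger0_norm e0) -nrmZR scaler_sumr.
  rewrite (_ : \sum_j _ = \sum_j (m n s j)%:C *: x j +
      \sum_j (- (m n s j - e * l s j))%:C *: x j); last first.
    rewrite -big_split/=; apply: eq_bigr => j _.
    by rewrite scalerA -rmorphM/= -scalerDl -rmorphD/= opprB addrC subrK.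
  apply: le_trans (nrm_sqrD_le _ _) _.
  rewrite ler_wpM2l// lerD2l ler_sqr ?nnegrE ?nrm_ge0//; last first.
    by apply: sumr_ge0 => j _; rewrite mulr_ge0 ?nrm_ge0.
  apply: le_trans (ler_nrm_sum _ _ _) _; apply: ler_sum => j _.
  by rewrite nrmZR normrN.
have near_le : \forall n \near \oo,
    e ^+ 2 * radsq (fun p => \sum_j (Z p j)%:C *: x j) <=
    4 * D + avg (fun s => 2 * rho n s ^+ 2).
  (* The total mass of the Riesz density tends to 1, hence is eventually at most 2. With the factor
     2 of [step] this gives the 4. *)
  have : \forall n \near \oo, forall s, avg (fun w => @rz n s w) <= 2.
    apply: filter_forall => s.
    apply: (cvgr_le _ (cvg_avg_riesz Zortho s)).
    by rewrite ltr1n.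
  apply: filterS => n Vn.
  rewrite /radsq -avgZ; apply: le_trans (ler_avg (step n)) _.
  have h (s : {ffun I -> bool}) : 2 * (nrm (\sum_j (m n s j)%:C *: x j) ^+ 2 + rho n s ^+ 2) <=
      4 * avg (fun w => @rz n s w * nrm (@z n w) ^+ 2) + 2 * rho n s ^+ 2.
    rewrite mulrDr lerD2r (_ : 4 = 2 * 2 :> R); last by rewrite -natrM.
    rewrite -mulrA ler_wpM2l//; apply: le_trans (mean_le n s) _.
    rewrite ler_wpM2r//; apply: avg_ge0 => w.
    by rewrite mulr_ge0 ?riesz_ge0// sqr_ge0.
  apply: le_trans (ler_avg h) _; rewrite avgD lerD2r avgZ ler_wpM2l//.
  (* Averaged over [s] first, the densities become 1 and only the mean of [nrm (z w) ^+ 2]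
     remains. *)
  rewrite exchange_avg; apply: le_trans (avg_nrm_z n).
  rewrite le_eqVlt; apply/orP; left; apply/eqP; apply: eq_avg => w.
  under eq_avg => s do rewrite mulrC.
  by rewrite avgZ avg_riesz mulr1.
have : e ^+ 2 * radsq (fun p => \sum_j (Z p j)%:C *: x j) <= 4 * D.
  rewrite -[leRHS]addr0.
  apply: (ler_cvg_to (cvg_cst _) _ near_le).
  apply: cvgD; first exact: cvg_cst.
    rewrite /avg -[X in _ --> X](mulr0 (#|{ffun I -> bool}|%:R^-1)).
    apply: cvgM; first exact: cvg_cst.
    rewrite [X in _ --> X](_ : 0 = \sum_(s : {ffun I -> bool}) 2 * (0 * 0)); last first.
      by rewrite big1// => s _; rewrite !mulr0.
    apply: (@cvg_sumr R _ _ _ (fun n s => 2 * rho n s ^+ 2) (fun=> 2 * (0 * 0))) => s.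
    apply: cvgM; first exact: cvg_cst.
    by apply: cvgM; exact: cvg_rho.
move=> h; rewrite -(ler_pM2l (expR_gt0 (-1))) [leRHS]mulrA -expRD addNr expR0 mul1r.
apply: le_trans h; rewrite le_eqVlt; apply/orP; left; apply/eqP; congr (_ * _).
by rewrite /e expr2 -expRD; congr expR; field.
Qed.

End riesz_bound.

(** * Contraction matrices *)

Definition posdef (R : rcfType) n (M : 'M[R]_n) : Prop :=
  M^T = M /\ forall v : 'rV[R]_n, v != 0 -> 0 < (v *m M *m v^T) 0 0.

(** Cholesky factorisation, by induction on the size through the Schur complement of the corner
    entry. *)
Lemma posdef_factor (R : rcfType) n (M : 'M[R]_n) : posdef M ->
  exists B : 'M[R]_n, B *m B^T = M.
Proof.
elim: n M => [|n IH]; first by move=> M _; exists 0; apply/matrixP => -[].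
suff: forall M : 'M[R]_(1 + n), posdef M -> exists B : 'M[R]_(1 + n), B *m B^T = M.
  by [].
move=> M [Msym Mpos].
pose a := M 0 0; pose u := ursubmx M; pose N := drsubmx M.
have defM : M = block_mx a%:M u u^T N.
  rewrite -[LHS]submxK; congr block_mx.
  - by rewrite [LHS]mx11_scalar; congr (_%:M); rewrite !mxE; congr (M _ _); exact/val_inj.
  - by rewrite /u -{1}Msym; apply/matrixP => i j; rewrite !mxE.
have a0 : 0 < a.
  have := Mpos (delta_mx 0 0); rewrite -rowE trmx_delta -colE !mxE; apply.
  by apply/eqP => /matrixP/(_ 0 0)/eqP; rewrite !mxE !eqxx oner_eq0.
have Nsym : N^T = N by rewrite /N trmx_drsub Msym.
pose N' := N - a^-1 *: (u^T *m u).
have [|B BN] := IH N'; first split.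
- by rewrite /N' linearB linearZ/= trmx_mul trmxK Nsym.
(* With this [s] the first block of the product vanishes, and the form of [M] at [(s, w)] equals
   that of the Schur complement at [w]. *)
- move=> w w0; pose s := - a^-1 *: (w *m u^T).
  have := Mpos (row_mx s w); rewrite defM mul_row_block tr_row_mx mul_row_col.
  rewrite (_ : s *m a%:M + w *m u^T = 0) ?mul0mx ?add0r; last first.
    by rewrite mul_mx_scalar scalerA mulrN mulfV ?gt_eqF// scaleN1r addNr.
  rewrite (_ : s *m u + w *m N = w *m N'); last first.
    by rewrite /N' mulmxBr -scalemxAr mulmxA /s -scalemxAl scaleNr addrC.
  apply; apply: contra_neq w0 => /(congr1 rsubmx).
  by rewrite row_mxKr linear0.
pose r := Num.sqrt a.
have r0 : r != 0 by rewrite gt_eqF// sqrtr_gt0.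
have r2 : r * r = a by rewrite -expr2 sqr_sqrtr// ltW.
exists (block_mx r%:M 0 (r^-1 *: u^T) B).
rewrite tr_block_mx mulmx_block !trmx0 !mul0mx !mulmx0 !addr0 [RHS]defM.
rewrite tr_scalar_mx linearZ/= trmxK -scalar_mxM r2 mul_scalar_mx scalerA mulfV//.
rewrite scale1r mul_mx_scalar scalerA mulfV// scale1r BN.
rewrite -scalemxAl -scalemxAr scalerA -invfM r2 /N' addrC subrK.
by [].
Qed.

Section contraction_posdef.
Context (R : realType) (n : nat).

Lemma sqr_nrmC (z : R[i]) :
  nrm (z : R[i]^o) ^+ 2 = complex.Re z ^+ 2 + complex.Im z ^+ 2.
Proof. by rewrite nrmC sqr_sqrtr// addr_ge0// sqr_ge0. Qed.

Lemma sqr_l2norm (v : 'cV[R[i]]_n) :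
  l2norm v ^+ 2 = \sum_i nrm (v i 0 : R[i]^o) ^+ 2.
Proof. by rewrite sqr_sqrtr// sumr_ge0// => i _; rewrite sqr_ge0. Qed.

Lemma l2norm_ge0 (v : 'cV[R[i]]_n) : 0 <= l2norm v.
Proof. exact: sqrtr_ge0. Qed.

Lemma mulmx_tr_row (v : 'rV[R]_n) m (B : 'M[R]_(n, m)) :
  (v *m (B *m B^T) *m v^T) 0 0 = \sum_j ((v *m B) 0 j) ^+ 2.
Proof.
rewrite mulmxA -mulmxA -trmx_mul mxE; apply: eq_bigr => j _.
by rewrite [in X in _ * X]mxE expr2.
Qed.

(* M M^* <= l^2 is derived from the bound |M w| <= l |w| at w = (v M)^*. *)
Lemma contraction_posdef (M : 'M[R[i]]_n) (l L : R) : 0 <= l -> l < L ->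
  (forall v, l2norm (M *m v) <= l * l2norm v) ->
  let A1 := L^-1 *: map_mx (@complex.Re R) M in
  let A2 := L^-1 *: map_mx (@complex.Im R) M in
  posdef (1%:M - A1 *m A1^T - A2 *m A2^T).
Proof.
move=> l0 lL Ml A1 A2; have L0 : 0 < L by exact: le_lt_trans lL.
split; first by rewrite !linearB/= !trmx_mul !trmxK trmx1.
move=> v v0.
have subE (B C : 'M[R]_1) : (B - C) 0 0 = B 0 0 - C 0 0 by rewrite !mxE.
rewrite !mulmxBr !mulmxBl !subE !mulmx_tr_row.
have -> : (v *m 1%:M *m v^T) 0 0 = \sum_j v 0 j ^+ 2.
  by rewrite mulmx1 mxE; apply: eq_bigr => j _; rewrite mxE expr2.
pose c1 := v *m map_mx (@complex.Re R) M; pose c2 := v *m map_mx (@complex.Im R) M.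
pose w : 'cV[R[i]]_n := \col_j (c1 0 j -i* c2 0 j).
pose r p := complex.Re ((M *m w) p 0).
pose V := \sum_j v 0 j ^+ 2; pose S := \sum_j (c1 0 j ^+ 2 + c2 0 j ^+ 2).
have V0 : 0 < V.
  rewrite lt_neqAle sumr_ge0 ?andbT => [|j _]; last by rewrite sqr_ge0.
  apply: contraNneq v0 => /esym/eqP; rewrite psumr_eq0 => [/allP h|j _]; last exact: sqr_ge0.
  apply/eqP/rowP => j; rewrite mxE; apply/eqP; rewrite -sqrf_eq0.
  by apply: h; rewrite mem_index_enum.
have S0 : 0 <= S by apply: sumr_ge0 => j _; rewrite addr_ge0 ?sqr_ge0.
have rS : \sum_p v 0 p * r p = S.
  transitivity (\sum_p \sum_j (v 0 p * complex.Re (M p j) * c1 0 j +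
      v 0 p * complex.Im (M p j) * c2 0 j)).
    apply: eq_bigr => p _; rewrite /r mxE raddf_sum/= mulr_sumr; apply: eq_bigr => j _.
    by rewrite mxE; case: (M p j) => x y /=; ring.
  rewrite exchange_big/=; apply: eq_bigr => j _.
  rewrite big_split/= -!mulr_suml !expr2.
  by congr (_ * _ + _ * _); rewrite mxE; apply: eq_bigr => p _; rewrite mxE.
have r2 : \sum_p r p ^+ 2 <= l ^+ 2 * S.
  have -> : S = l2norm w ^+ 2.
    by rewrite sqr_l2norm; apply: eq_bigr => j _; rewrite sqr_nrmC [w j 0]mxE/= sqrrN.
  apply: (@le_trans _ _ (l2norm (M *m w) ^+ 2)).
    rewrite sqr_l2norm; apply: ler_sum => p _; rewrite sqr_nrmC lerDl.
    exact: sqr_ge0.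
  by rewrite -exprMn ler_sqr ?nnegrE ?mulr_ge0 ?l2norm_ge0.
(* [2 v r <= L^2 v^2 + L^-2 r^2] coordinatewise. As [l < L], the last term is less than [S] unless
   [S = 0], which leaves [S < L^2 V]. *)
have key : 2 * S <= L ^+ 2 * V + L ^- 2 * (l ^+ 2 * S).
  apply: (@le_trans _ _ (L ^+ 2 * V + L ^- 2 * \sum_p r p ^+ 2)); last first.
    by rewrite lerD2l ler_wpM2l// invr_ge0 sqr_ge0.
  rewrite -rS /V !mulr_sumr -big_split/=; apply: ler_sum => p _.
  rewrite -subr_ge0.
  have -> : L ^+ 2 * v 0 p ^+ 2 + L ^- 2 * r p ^+ 2 - 2 * (v 0 p * r p) =
     (L * v 0 p - L^-1 * r p) ^+ 2 by field; rewrite gt_eqF.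
  exact: sqr_ge0.
have -> : \sum_j (v 0 j) ^+ 2 - \sum_j ((v *m A1) 0 j) ^+ 2 -
    \sum_j ((v *m A2) 0 j) ^+ 2 = V - L ^- 2 * S.
  rewrite -addrA -opprD -big_split/= /S mulr_sumr; congr (_ - _).
  apply: eq_bigr => j _.
  have sc (B : 'M[R]_n) : (v *m (L^-1 *: B)) 0 j = L^-1 * (v *m B) 0 j.
    by rewrite -scalemxAr mxE.
  by rewrite /A1 /A2 !sc !exprMn -mulrDr exprVn.
have q1 : L ^- 2 * l ^+ 2 < 1.
  by rewrite mulrC ltr_pdivrMr ?exprn_gt0// mul1r ltr_sqr ?nnegrE// ltW.
have L20 : 0 < L ^+ 2 by rewrite exprn_gt0.
rewrite -(pmulr_rgt0 _ L20) mulrBr mulrA mulfV ?gt_eqF// mul1r.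
move: key; rewrite mulrA; move: q1; set q := _ * _ => q1 key.
have [S00|] := eqVneq S 0; first by rewrite S00 subr0 mulr_gt0.
rewrite neq_lt ltNge S0/= => Spos.
have : q * S < S by rewrite gtr_pMl.
lra.
Qed.

End contraction_posdef.

Section padding.
Context (R : realType) (X : normedModType R[i]).

Lemma avg_pair (F : fieldType) (T S : finType) (f : T * S -> F) :
  avg f = avg (fun t => avg (fun s => f (t, s))).
Proof.
rewrite /avg -mulr_sumr pair_bigA mulrA -invfM -natrM -card_prod.
by congr (_ * _); apply: eq_bigr => -[].
Qed.

(** The signs on [I'] multiply zero vectors only. Zero padding allows columns to be added to a
    matrix. *)
Lemma radsq_inl (I I' : finType) (x : I -> X) :
  radsq (fun j : I + I' => if j is inl i then x i else 0) = radsq x.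
Proof.
pose h (p : {ffun I -> bool} * {ffun I' -> bool}) : {ffun I + I' -> bool} :=
  [ffun j => match j with inl i => p.1 i | inr i => p.2 i end].
rewrite /radsq (reindex_avg (h := h)); last first.
  exists (fun w : {ffun I + I' -> bool} => ([ffun i => w (inl i)], [ffun i => w (inr i)])).
    by move=> [p q]; congr pair; apply/ffunP => i; rewrite !ffunE.
  by move=> w; apply/ffunP => -[] i; rewrite !ffunE.
rewrite avg_pair; apply: eq_avg => v.
rewrite -[RHS](avg_cst (T := {ffun I' -> bool})) ?card_signs_gt0//.
apply: eq_avg => v'; congr (nrm _ ^+ 2); rewrite big_sumType/= [X in _ + X]big1.
  by rewrite addr0; apply: eq_bigr => i _; rewrite ffunE.
by move=> i _; rewrite scaler0.
Qed.

End padding.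

(** * Scalar block-diagonal matrices acting on Rademacher sums *)

Section contraction.
Context (R : realType) (X : normedModType R[i]) (D : R).
Hypotheses (D0 : 0 <= D) (hD : sign_alpha X D).
Context (T : finType) (n : nat).

Lemma radsq_real_contraction_le m (A : T -> 'M[R]_n) (A' : T -> 'M[R]_(n, m))
    (y : T * 'I_n -> X) :
  (forall k, A k *m (A k)^T + A' k *m (A' k)^T = 1%:M) ->
  radsq (fun p => \sum_(j < n) (A p.1 p.2 j)%:C *: y (p.1, j)) <=
  expR 1 * (4 * (D * radsq y)).
Proof.
move=> AA.
(* Block diagonal over [T], with blocks [[A k, A' k]], whose rows are orthonormal; the columns of
   [A'] meet the zero entries of [x]. *)
pose Z (p : T * 'I_n) (q : (T * 'I_n) + (T * 'I_m)) : R := match q with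
  | inl q => (p.1 == q.1)%:R * A p.1 p.2 q.2
  | inr q => (p.1 == q.1)%:R * A' p.1 p.2 q.2 end.
pose x (q : (T * 'I_n) + (T * 'I_m)) := if q is inl q then y q else 0.
have Zo p q : \sum_j Z p j * Z q j = (p == q)%:R.
  have blk k (B : T -> 'M[R]_(n, k)) :
     \sum_(j : T * 'I_k) ((p.1 == j.1)%:R * B p.1 p.2 j.2) *
        ((q.1 == j.1)%:R * B q.1 q.2 j.2) =
     (p.1 == q.1)%:R * (B p.1 *m (B p.1)^T) p.2 q.2.
    rewrite -(pair_bigA _ (fun l i => ((p.1 == l)%:R * B p.1 p.2 i) *
        ((q.1 == l)%:R * B q.1 q.2 i)))/=.
    rewrite (bigD1 p.1)//= eqxx [X in _ + X]big1 ?addr0; last first.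
      move=> l /negbTE pl; rewrite big1// => i _.
      by rewrite eq_sym pl mul0r mul0r.
    rewrite mxE mulr_sumr; apply: eq_bigr => i _; rewrite mul1r mxE.
    rewrite [q.1 == _]eq_sym; case: eqP => [<-|_]; first by rewrite !mul1r.
    by rewrite !mul0r mulr0.
  rewrite big_sumType/= (blk n A) (blk m A') -mulrDr.
  have := AA p.1 => /matrixP/(_ p.2 q.2); rewrite !mxE => ->.
  by rewrite -natrM mulnb -pair_eqE.
apply: le_trans (radsq_ortho_le (x := x) Zo (D := D * radsq y) _).
  rewrite le_eqVlt; apply/orP; left; apply/eqP; apply: eq_radsq => p.
  rewrite big_sumType/= [X in _ = _ + X]big1 ?addr0; last first.
    by move=> j _; rewrite scaler0.
  transitivity (\sum_l \sum_i ((p.1 == l)%:R * A p.1 p.2 i)%:C *: y (l, i)).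
    rewrite (bigD1 p.1)//= eqxx [X in _ = _ + X]big1 ?addr0; last first.
      move=> l /negbTE pl; rewrite big1// => i _.
      by rewrite eq_sym pl mul0r rmorph0 scale0r.
    by apply: eq_bigr => i _; rewrite mul1r.
  by rewrite pair_bigA/=; apply: eq_bigr => -[].
by move=> N; rewrite -(radsq_inl (T * 'I_m)%type y); exact: radsq_spread_le.
Qed.

(** Real and imaginary parts of [A / L] are treated separately. Each is completed to orthonormal
    rows by the other part and a factor [B] of the defect, which is positive definite because
    [l < L]. Recombining them gives [16 = 2 * (4 + 4)]. *)
Lemma radsq_contraction_le (A : T -> 'M[R[i]]_n) (y : T * 'I_n -> X) (l L : R) :
  0 <= l -> l < L ->
  (forall k v, l2norm (A k *m v) <= l * l2norm v) ->
  radsq (fun p => \sum_(j < n) A p.1 p.2 j *: y (p.1, j)) <=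
  L ^+ 2 * (16 * expR 1 * D * radsq y).
Proof.
move=> l0 lL Al.
have L0 : 0 < L by exact: le_lt_trans lL.
pose A1 k := L^-1 *: map_mx (@complex.Re R) (A k).
pose A2 k := L^-1 *: map_mx (@complex.Im R) (A k).
have /choice[B BA] : forall k, exists B : 'M[R]_n,
    A1 k *m (A1 k)^T + A2 k *m (A2 k)^T + B *m B^T = 1%:M.
  move=> k; have [|B BB] := @posdef_factor R n (1%:M - A1 k *m (A1 k)^T - A2 k *m (A2 k)^T).
    exact: contraction_posdef l0 lL (Al k).
  by exists B; rewrite BB -[X in _ + X]addrA -opprD addrC addrA subrr add0r.
have h1 := radsq_real_contraction_le (A := A1)
  (A' := fun k => row_mx (A2 k) (B k)) y _.
have h2 := radsq_real_contraction_le (A := A2)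
  (A' := fun k => row_mx (A1 k) (B k)) y _.
have {}h1 := h1 ltac:(by move=> k; rewrite tr_row_mx mul_row_col addrA).
have {}h2 := h2 ltac:(by move=> k; rewrite tr_row_mx mul_row_col addrA [X in X + _]addrC).
pose z1 p := \sum_(j < n) (A1 p.1 p.2 j)%:C *: y (p.1, j).
pose z2 p := \sum_(j < n) (A2 p.1 p.2 j)%:C *: y (p.1, j).
rewrite (eq_radsq (y := fun p => L%:C *: (z1 p + 'i *: z2 p))); last first.
  move=> p; rewrite /z1 /z2 scaler_sumr -big_split/= scaler_sumr.
  apply: eq_bigr => j _; rewrite scalerA -scalerDl scalerA; congr (_ *: _).
  rewrite /A1 /A2 !mxE; case: (A p.1 p.2 j) => a b /=.
  by apply/eqP; rewrite eq_complex/=; apply/andP; split; apply/eqP;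
    field; rewrite gt_eqF.
rewrite radsqZ nrmR real_normK ?num_real// ler_wpM2l ?sqr_ge0//.
apply: le_trans (radsqD_le _ _) _.
rewrite (radsqZ 'i z2) (_ : nrm ('i : R[i]^o) = 1); last first.
  by rewrite nrmC/= expr0n expr1n add0r sqrtr1.
rewrite expr1n mul1r.
have -> : 16 * expR 1 * D * radsq y =
    2 * (expR 1 * (4 * (D * radsq y)) + expR 1 * (4 * (D * radsq y))) by ring.
by rewrite ler_wpM2l// lerD.
Qed.

End contraction.

(** * Almost partitions of unity *)

Section hat_function.
Context (R : realType).
Implicit Types y z : R.

(** The tent [max(0, 1 - |z|)], written as a second difference so that sums of integer translates
    telescope. *)
Definition hat z : R := (`|z + 1| - 2 * `|z| + `|z - 1|) / 2.

Lemma hat_ge0 z : 0 <= hat z.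
Proof.
rewrite /hat; have := ler_normD (z + 1) (z - 1).
have -> : z + 1 + (z - 1) = 2 * z by ring.
by rewrite normrM (@ger0_norm _ 2)//; lra.
Qed.

Lemma hat_neq0 z : hat z != 0 -> `|z| < 1.
Proof.
apply: contraNlt; rewrite /hat => z1; apply/eqP.
have [z0|z0] := lerP 0 z.
  rewrite (ger0_norm z0) in z1 *.
  by rewrite !ger0_norm ?subr_ge0 ?addr_ge0//; lra.
rewrite (ltr0_norm z0) in z1 *.
by rewrite (@ler0_norm _ (z + 1)) ?(@ler0_norm _ (z - 1)); lra.
Qed.

Lemma continuous_hat : continuous hat.
Proof.
move=> z; apply: cvgM; last exact: cvg_cst.
apply: cvgD.
  apply: cvgB; first by apply: cvg_norm; apply: cvgD; [exact: cvg_id|exact: cvg_cst].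
  by apply: cvgM; [exact: cvg_cst|apply: cvg_norm; exact: cvg_id].
by apply: cvg_norm; apply: cvgB; [exact: cvg_id|exact: cvg_cst].
Qed.

Lemma sum_hat y L : 0 <= y -> y + 1 <= L%:R -> \sum_(r < L) hat (y - r%:R) = 1.
Proof.
(* [clamp] truncates to [[0, 1]], and [hat z = clamp (z + 1) - clamp z]. *)
pose clamp z : R := (`|z| - `|z - 1| + 1) / 2.
have tele n : \sum_(r < n) hat (y - r%:R) = clamp (y + 1) - clamp (y + 1 - n%:R).
  elim: n => [|n IH]; first by rewrite big_ord0 subr0 subrr.
  rewrite big_ord_recr/= IH /clamp /hat -[n.+1%:R]natr1.
  have -> : y + 1 - (n%:R + 1) = y - n%:R by ring.
  have -> : y + 1 - n%:R - 1 = y - n%:R by ring.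
  have -> : y + 1 - n%:R = y - n%:R + 1 by ring.
  by field.
move=> y0 yL; rewrite tele /clamp (@ger0_norm _ (y + 1)); last lra.
rewrite addrK (ger0_norm y0) (@ler0_norm _ (y + 1 - L%:R)) ?subr_le0//.
by rewrite (@ler0_norm _ (y + 1 - L%:R - 1)); lra.
Qed.

End hat_function.

(* For each [s], the functions [psi s k] have disjoint supports, on which all
   functions in [G] are almost constant.  They do not sum to 1, but almost do on
   average over [s]. *)
Record splitting (R : realType) (K : topologicalType) (G : set (K -> R)) (h : R)
    (S T : finType) (psi : S -> T -> K -> R) : Prop := Splitting {
  splitting_gt0 : (0 < #|S|)%N ;
  splitting_continuous : forall s k, continuous (psi s k) ;
  splitting_ge0 : forall s k t, 0 <= psi s k t ;
  splitting_disjoint : forall s k l t, k != l -> psi s k t * psi s l t = 0 ;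
  splitting_le1 : forall s t, \sum_k psi s k t <= 1 ;
  splitting_avg : forall t, 1 - h <= avg (fun s => \sum_k psi s k t) ;
  splitting_osc : forall g s k t t', G g -> psi s k t != 0 -> psi s k t' != 0 ->
    `|g t - g t'| <= h }.

Section one_function.
Context (R : realType) (K : topologicalType) (g : K -> R) (B h : R).
Hypotheses (gcont : continuous g) (gB : forall t, `|g t| <= B) (h0 : 0 < h).

(** [m - 1] exceeds [1 / h], so dropping one node in [m] costs at most [h]. The scale [c] makes a
    variation of [m + 1] in [y] one of [h] in [g], and [L] nodes cover the range of [y]. [|B|]
    replaces [B], which may be negative when [K] is empty. *)
Let m := (Num.bound h^-1).+1.
Let c : R := m.+1%:R / h.
Let L := (Num.bound (2 * `|B| * c)).+2.
Let y t := (g t + `|B|) * c.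

(* With shift [s], the nodes [r = s] modulo [m] are dropped; the nodes between
   consecutive dropped ones form a block. *)
Let q (s : 'I_m) (r : 'I_L) : nat := r + (m - s).
Let kept s r (k : 'I_(L + m)) := (~~ (m %| q s r) && (q s r %/ m == k))%N.
Let psi (s : 'I_m) (k : 'I_(L + m)) (t : K) : R :=
  \sum_r (kept s r k)%:R * hat (y t - r%:R).

Let c0 : 0 < c.
Proof. by rewrite divr_gt0. Qed.

Let psi_neq0 s k t : psi s k t != 0 ->
  exists2 r, kept s r k & `|y t - r%:R| < 1.
Proof.
move=> h1; apply: contrapT => h2; move/eqP: h1; apply.
rewrite /psi big1// => r _; case: (boolP (kept s r k)) => kr; last by rewrite mul0r.
have [->|/hat_neq0 hr] := eqVneq (hat (y t - r%:R)) 0; first by rewrite mulr0.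
by case: h2; exists r.
Qed.

(** The quotient by [m] changes only at a multiple of [m], and such nodes are dropped; so equal or
    neighbouring kept nodes share a block. *)
Let kept_unique s r r' k l : kept s r k -> kept s r' l ->
  (r <= r')%N -> (r' <= r.+1)%N -> k = l.
Proof.
move=> /andP[_ /eqP kr] /andP[n' /eqP lr'] rr' r'r.
apply/val_inj; rewrite /= -kr -lr'.
have [e|ne] := eqVneq (r : nat) r'; first by rewrite /q e.
have e : q s r' = (q s r).+1 by rewrite /q; lia.
by rewrite e divnS// -e (negbTE n').
Qed.

Let sum_kept s r : \sum_k (kept s r k)%:R = (~~ (m %| q s r)%N)%:R :> R.
Proof.
have ql : (q s r %/ m < L + m)%N.
  apply: leq_ltn_trans (leq_div _ _) _; rewrite /q.
  by have := ltn_ord r; have := leq_subr s m; lia.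
rewrite (bigD1 (Ordinal ql))//= /kept/= eqxx andbT big1 ?addr0// => k kq.
by case: eqP => [e|]; rewrite ?andbF//; case/eqP: kq; exact/val_inj.
Qed.

(** A node [r] is dropped for the shift [r %% m] only. *)
Let sum_dropped (r : 'I_L) : \sum_s (~~ (m %| q s r)%N)%:R >= m.-1%:R :> R.
Proof.
have -> : \sum_s (~~ (m %| q s r)%N)%:R = \sum_(s : 'I_m) (1 - (m %| q s r)%N%:R) :> R.
  by apply: eq_bigr => s _; case: (m %| _)%N; rewrite ?subrr ?subr0.
rewrite sumrB sumr_const card_ord lerBrDr -[m in leRHS]/(m.-1.+1) -[leRHS]natr1 lerD2l.
have rm : (r %% m < m)%N by rewrite ltn_mod.
rewrite (bigD1 (Ordinal rm))//= big1 ?addr0 ?lern1 ?leq_b1// => s sr.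
case: (boolP (m %| q s r)%N) => // /dvdnP[j qj]; case/eqP: sr; apply/val_inj => /=.
have : (r + m = s + j * m)%N by rewrite -qj /q; have := ltn_ord s; lia.
move=> /(congr1 (modn^~ m)); rewrite modnDr addnC modnMDl.
by rewrite [(s %% m)%N]modn_small.
Qed.

Let sum_hat_y t : \sum_(r < L) hat (y t - r%:R) = 1.
Proof.
have Bg : - `|B| <= g t <= `|B|.
  by rewrite -ler_norml; apply: le_trans (gB t) (ler_norm _).
have y0 : 0 <= y t by rewrite mulr_ge0 ?(ltW c0)//; lra.
apply: sum_hat => //.
have : y t <= 2 * `|B| * c by rewrite /y ler_wpM2r ?(ltW c0)//; lra.
have := @archi_boundP R (2 * `|B| * c) ltac:(by rewrite mulr_ge0 ?(ltW c0)// mulr_ge0).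
rewrite /L -!natr1; lra.
Qed.

Lemma exists_splitting1 : exists (S T : finType) (psi : S -> T -> K -> R),
  splitting [set g] h psi.
Proof.
exists 'I_m, 'I_(L + m), psi; split.
- by rewrite card_ord.
- move=> s k t; apply: cvg_sumr => r; apply: cvgM; first exact: cvg_cst.
  apply: continuous_cvg; first exact: continuous_hat.
  apply: cvgB; last exact: cvg_cst.
  apply: cvgM; last exact: cvg_cst.
  by apply: cvgD; [exact: gcont|exact: cvg_cst].
- by move=> s k t; apply: sumr_ge0 => r _; rewrite mulr_ge0 ?hat_ge0.
(* If both functions are nonzero at [t], two kept nodes lie at distance less than 2, hence at most
   1, and belong to one block. *)
- move=> s k l t kl; have [->|/psi_neq0[r kr hr]] := eqVneq (psi s k t) 0.
    by rewrite mul0r.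
  have [->|/psi_neq0[r' kr' hr']] := eqVneq (psi s l t) 0; first by rewrite mulr0.
  have : `|r%:R - r'%:R| < 2 :> R.
    have -> : r%:R - r'%:R = (y t - r'%:R) - (y t - r%:R) by ring.
    by apply: le_lt_trans (ler_normB _ _) _; lra.
  rewrite ltr_norml => /andP[h1 h2]; case/eqP: kl.
  have [rr'|/ltnW r'r] := leqP r r'.
    apply: (kept_unique kr kr') => //; rewrite -ltnS -(ltr_nat R) -!natr1; lra.
  apply/esym/(kept_unique kr' kr) => //; rewrite -ltnS -(ltr_nat R) -!natr1; lra.
- move=> s t; rewrite -(sum_hat_y t) exchange_big/=; apply: ler_sum => r _.
  rewrite -mulr_suml sum_kept ler_piMl ?hat_ge0//.
  by case: (~~ _).
- move=> t; rewrite /avg card_ord.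
  under eq_bigr => s _.
    rewrite exchange_big/=.
    under eq_bigr => r _ do rewrite -mulr_suml sum_kept.
    over.
  rewrite exchange_big/=.
  apply: (@le_trans _ _ (m%:R^-1 * \sum_(r < L) m.-1%:R * hat (y t - r%:R))).
    rewrite -mulr_sumr sum_hat_y mulr1 ler_pdivlMl//.
    have hV0 : 0 <= h^-1 by rewrite invr_ge0 ltW.
    have h1 : h^-1 < m.-1%:R := archi_boundP hV0.
    have mE : m%:R = m.-1%:R + 1 :> R by rewrite natr1.
    have : 1 < m.-1%:R * h by rewrite -ltr_pdivrMr// div1r.
    have aux a b : 0 < b -> 1 < a * b -> (a + 1) * (1 - b) <= a :> R.
      by move=> ? ?; nra.
    by rewrite mE; exact: aux.
  rewrite ler_wpM2l ?invr_ge0//; apply: ler_sum => r _.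
  by rewrite -mulr_suml ler_wpM2r ?hat_ge0// sum_dropped.
- move=> _ s k t t' -> /psi_neq0[r kr hr] /psi_neq0[r' kr' hr'].
  (* Nodes of one block differ by at most [m - 1], and each point is within 1 of its node; hence the
     bound [m + 1]. *)
  have le_block (r1 r2 : 'I_L) : kept s r1 k -> kept s r2 k ->
      r1%:R <= r2%:R + m%:R - 1 :> R.
    move=> /andP[_ /eqP k1] /andP[_ /eqP k2].
    have h1 := ltn_ceil (q s r1) (isT : (0 < m)%N); have h2 := leq_trunc_div (q s r2) m.
    rewrite lerBrDr natr1 -natrD ler_nat.
    by move: h1 h2; rewrite k1 k2 mulSn /q; lia.
  have yy : `|y t - y t'| <= m.+1%:R.
    have := le_block _ _ kr kr'; have := le_block _ _ kr' kr.
    move: hr hr'; rewrite !ltr_norml -[m.+1%:R]natr1 => /andP[? ?] /andP[? ?] ? ?.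
    by rewrite ler_norml; apply/andP; split; lra.
  rewrite -(ler_pM2r c0) -[X in _ * X <= _](gtr0_norm c0) -normrM.
  have -> : (g t - g t') * c = y t - y t' by rewrite /y; ring.
  by rewrite /c mulrC divfK// gt_eqF.
Qed.

End one_function.

Section splittings.
Context (R : realType) (K : topologicalType).

Lemma splitting_sub (G G' : set (K -> R)) h (S T : finType) (psi : S -> T -> K -> R) :
  G' `<=` G -> splitting G h psi -> splitting G' h psi.
Proof. by move=> sub [? ? ? ? ? ? osc]; split => // g s k t t' /sub; exact: osc. Qed.

(** Products of the two families; the means over [s] multiply too, since the two shifts vary
    independently. *)
Lemma splittingU (G1 G2 : set (K -> R)) (h1 h2 : R) (S1 T1 S2 T2 : finType)
    (psi1 : S1 -> T1 -> K -> R) (psi2 : S2 -> T2 -> K -> R) :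
  0 <= h1 -> 0 <= h2 -> splitting G1 h1 psi1 -> splitting G2 h2 psi2 ->
  splitting (G1 `|` G2) (h1 + h2) (fun (s : S1 * S2) (k : T1 * T2) t =>
    psi1 s.1 k.1 t * psi2 s.2 k.2 t).
Proof.
move=> h10 h20 [S10 c1 p1 d1 l1 a1 o1] [S20 c2 p2 d2 l2 a2 o2].
have sumE s t : \sum_(k : T1 * T2) psi1 s.1 k.1 t * psi2 s.2 k.2 t =
    (\sum_k psi1 s.1 k t) * (\sum_k psi2 s.2 k t).
  by rewrite big_distrlr/= pair_bigA.
split.
- by rewrite card_prod muln_gt0 S10.
- by move=> s k t; apply: cvgM; [exact: c1|exact: c2].
- by move=> s k t; rewrite mulr_ge0.
- move=> s k l t kl; rewrite mulrACA.
  have [e|ne] := eqVneq k.1 l.1; last by rewrite d1// mul0r.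
  rewrite [X in _ * X]d2 ?mulr0//; apply: contra_neq kl => e2.
  by rewrite [k]surjective_pairing [l]surjective_pairing e e2.
- move=> s t; rewrite sumE mulr_ile1 ?l1 ?l2//.
  + by apply: sumr_ge0 => k _.
  + by apply: sumr_ge0 => k _.
- move=> t; under eq_avg => s do rewrite sumE.
  rewrite avg_pair/=; under eq_avg => s do rewrite avgZ mulrC.
  rewrite avgZ.
  have := a1 t; have := a2 t.
  have : avg (fun s => \sum_k psi1 s k t) <= 1 by apply: avg_le.
  have : avg (fun s => \sum_k psi2 s k t) <= 1 by apply: avg_le.
  set a := avg _; set b := avg _ => b1 a1' b2 a2'.
  (* For [a] and [b] at most 1, [a * b >= a + b - 1]. *)
  have : 0 <= (1 - a) * (1 - b) by rewrite mulr_ge0// subr_ge0.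
  by nra.
- move=> g s k t t' Gg; rewrite !mulf_eq0 !negb_or => /andP[n1 n2] /andP[n1' n2'].
  case: Gg => Gg.
    by apply: (le_trans (o1 g s.1 k.1 t t' Gg n1 n1')); rewrite lerDl.
  by apply: (le_trans (o2 g s.2 k.2 t t' Gg n2 n2')); rewrite lerDr.
Qed.

Lemma exists_splitting (I : eqType) (r : seq I) (g : I -> K -> R) (h : R) :
  0 < h -> (forall i, continuous (g i)) ->
  (forall i, exists B, forall t, `|g i t| <= B) ->
  exists (S T : finType) (psi : S -> T -> K -> R),
    splitting [set f | exists2 i, i \in r & f = g i] h psi.
Proof.
move=> h0 gc gB; elim: r h h0 => [|i r IH] h h0.
  exists unit, unit, (fun _ _ _ => 1); split => //.
  - by rewrite card_unit.
  - by move=> _ _; exact: cst_continuous.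
  - by move=> s t; rewrite sumr_const card_unit.
  - move=> t; rewrite /avg !sumr_const card_unit invr1 mul1r; lra.
  - by move=> f s k t t' [].
have h2 : 0 < h / 2 by rewrite divr_gt0.
have [S [T [psi Hpsi]]] := IH _ h2.
have [B iB] := gB i.
have [S' [T' [psi' Hpsi']]] := exists_splitting1 (gc i) iB h2.
have := splittingU (ltW h2) (ltW h2) Hpsi' Hpsi.
rewrite (_ : h / 2 + h / 2 = h); last by field.
move=> H; do 3 eexists; apply: splitting_sub H => f [j].
rewrite inE => /orP[/eqP -> ->|jr ->]; [by left|].
by right; exists j.
Qed.

End splittings.

(** * Homomorphisms on C(K) *)

(** A set without a supremum has [sup] equal to 0. *)
Lemma sup_nneg (R : realType) (A : set R) : (forall x, A x -> 0 <= x) -> 0 <= sup A.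
Proof.
move=> A0; have [hA|nA] := pselect (has_sup A); last by rewrite sup_out.
by have [[x Ax] ubA] := hA; apply: le_trans (A0 _ Ax) (ub_le_sup ubA Ax).
Qed.

Section continuous_function_algebra.
Context (R : realType) (K : topologicalType).
Implicit Types f g : CK R[i] K.

Lemma CKM f g t : (f * g) t = (f t : R[i]) * g t.
Proof. by []. Qed.

Lemma CKZ (a : R[i]) f t : (a *: f) t = a * (f t : R[i]).
Proof. by []. Qed.

Lemma CKB f g t : (f - g) t = f t - g t.
Proof. by []. Qed.

Lemma CK_sum (I : Type) (r : seq I) (P : pred I) (F : I -> CK R[i] K) t :
  (\sum_(i <- r | P i) F i) t = \sum_(i <- r | P i) F i t.
Proof. by elim/big_rec2 : _ => [//|i a b _ <-]. Qed.

Lemma CK_eq f g : (forall t, f t = g t) -> f = g.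
Proof. by move=> fg; apply/val_inj/funext. Qed.

Lemma CK_scalerAl (a : R[i]) f g : (a *: f) * g = a *: (f * g).
Proof. by apply: CK_eq => t; rewrite CKZ !CKM CKZ mulrA. Qed.

Lemma continuous_nrm f t (e : R) : 0 < e ->
  \forall t' \near t, nrm (f t - f t') < e.
Proof.
move=> e0; have /cfunP/(_ t)/cvgrPdist_lt/(_ e%:C) := CK_in f.
rewrite ltcR => /(_ e0); apply: filterS => t'.
by rewrite nrmE ltcR.
Qed.

Lemma ler_Re (z : R[i]) : `|complex.Re z| <= nrm (z : R[i]^o).
Proof.
by rewrite -sqrtr_sqr nrmC ler_sqrt ?addr_ge0 ?sqr_ge0// lerDl sqr_ge0.
Qed.

Lemma ler_Im (z : R[i]) : `|complex.Im z| <= nrm (z : R[i]^o).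
Proof.
by rewrite -sqrtr_sqr nrmC ler_sqrt ?addr_ge0 ?sqr_ge0// lerDr sqr_ge0.
Qed.

Lemma nrm_le_ReIm (z : R[i]) :
  nrm (z : R[i]^o) <= `|complex.Re z| + `|complex.Im z|.
Proof.
rewrite nrmC -[leRHS]ger0_norm ?addr_ge0// -sqrtr_sqr ler_sqrt ?sqr_ge0//.
rewrite sqrrD !real_normK ?num_real// lerD2r lerDl.
by rewrite mulrn_wge0 ?mulr_ge0.
Qed.

(** The Boolean lets the real and imaginary parts of all matrix entries form one finite family. *)
Definition part (b : bool) (z : R[i]) : R := if b then complex.Im z else complex.Re z.

Lemma continuous_part b f : continuous (fun t => part b (f t)).
Proof.
move=> t; apply/cvgrPdist_lt => e e0.
apply: filterS (continuous_nrm f t e0) => t'; apply: le_lt_trans.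
case: b; rewrite /part.
  by rewrite -raddfB; exact: ler_Im.
by rewrite -raddfB; exact: ler_Re.
Qed.

Lemma bounded_part (cK : compact [set: K]) b f :
  exists B, forall t, `|part b (f t)| <= B.
Proof.
have /compact_bounded : compact ((fun t => part b (f t)) @` [set: K]).
  apply: continuous_compact => //; apply: continuous_subspaceT.
  exact: continuous_part.
case=> B [Breal hB]; exists (B + 1) => t.
by apply: (hB (B + 1)); [rewrite ltrDl|exists t].
Qed.

Lemma continuous_real_complex (phi : K -> R) : continuous phi ->
  (fun t => (phi t)%:C : R[i]^o) \in @cfun R[i] K.
Proof.
move=> c; apply/cfunP => t; apply/cvgrPdist_lt => e e0.
have er : e = (complex.Re e)%:C by rewrite RRe_real// gtr0_real.
have r0 : 0 < complex.Re e by rewrite -ltcR -er.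
have /cvgrPdist_lt/(_ _ r0) := c t; apply: filterS => t' h.
by rewrite er -rmorphB/= nrmE nrmR ltcR.
Qed.

Definition realCK (phi : K -> R) (c : continuous phi) : CK R[i] K :=
  MkCK (continuous_real_complex c).

Lemma supnorm_ge0 f : 0 <= supnorm f.
Proof.
by apply: sup_nneg => _ [t _ <-]; exact: nrm_ge0.
Qed.

Lemma supnorm_le f (b : R) : 0 <= b -> (forall t, nrm (f t) <= b) -> supnorm f <= b.
Proof.
move=> b0 fb; have [[t _]|/set0P/negP/negPn/eqP K0] := pselect ([set: K] !=set0).
  by apply: ge_sup => [|_ [s _ <-]//]; exists (nrm (f t)), t.
by rewrite /supnorm K0 image_set0 sup0.
Qed.

End continuous_function_algebra.

Section bounded_homomorphism.
Context (R : realType) (K : topologicalType) (X : normedModType R[i]).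
Variable u : CK R[i] K -> BX X.
Hypothesis hu : bounded_homomorphism u.

Lemma homM f g x : u (f * g) x = u f (u g x).
Proof. by case: hu => _ h _; exact: h. Qed.

Lemma homD f g x : u (f + g) x = u f x + u g x.
Proof. by case: hu => h _ _; rewrite -{1}[f]scale1r h scale1r. Qed.

Lemma hom0 x : u 0 x = 0.
Proof. by apply: (addrI (u 0 x)); rewrite -homD !addr0. Qed.

Lemma homZ a f x : u (a *: f) x = a *: u f x.
Proof. by case: hu => h _ _; rewrite -[a *: f]addr0 h hom0 addr0. Qed.

Lemma hom_sum (I : Type) (r : seq I) (P : pred I) (F : I -> CK R[i] K) x :
  u (\sum_(i <- r | P i) F i) x = \sum_(i <- r | P i) u (F i) x.
Proof. by elim/big_rec2 : _ => [|i a b _ <-]; rewrite ?hom0 ?homD. Qed.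

(** The bound on the unit ball is extended by scaling; a pointwise bound [b] spares later
    computations of supremum norms. *)
Lemma hom_bound : exists2 M : R, 0 <= M & forall (f : CK R[i] K) (b : R) x, 0 <= b ->
  (forall t, nrm (f t) <= b) -> nrm (u f x) <= M * b * nrm x.
Proof.
case: hu => _ _ [M uM]; exists `|M| => // f b x b0 fb.
have fM : forall y, nrm y <= 1 -> nrm (u f y) <= `|M| * b.
  move=> y y1; rewrite -lee_fin.
  apply: (@le_trans _ _ (opnorm (u f))); first by apply: ereal_sup_ubound; exists y.
  apply: (le_trans (uM f)); rewrite lee_fin.
  apply: (@le_trans _ _ (`|M| * supnorm f)).
    by rewrite ler_wpM2r ?supnorm_ge0// ler_norm.
  by rewrite ler_wpM2l// supnorm_le.
have [x0|xn0] := eqVneq (nrm x) 0.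
  by rewrite (nrm_eq0 x0) linear0 !nrm0 mulr0.
have xp : 0 < nrm x by rewrite lt_neqAle eq_sym xn0 nrm_ge0.
have := fM (((nrm x)^-1)%:C *: x).
rewrite linearZ/= !nrmZR gtr0_norm ?invr_gt0// mulVf// => /(_ (lexx _)).
by rewrite ler_pdivrMl// mulrC.
Qed.

End bounded_homomorphism.

(** * Operator norms of matrices and of matrix-valued functions *)

Section matrix_norms.
Context (R : realType).

Lemma l2normZ n (a : R) (v : 'cV[R[i]]_n) : l2norm (a%:C *: v) = `|a| * l2norm v.
Proof.
rewrite -[RHS]ger0_norm ?mulr_ge0 ?l2norm_ge0// -sqrtr_sqr exprMn sqr_l2norm.
rewrite /l2norm mulr_sumr; congr Num.sqrt; apply: eq_bigr => i _.
by rewrite mxE -exprMn -nrmZR.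
Qed.

Lemma nrm_le_l2norm n (v : 'cV[R[i]]_n) i : nrm (v i 0 : R[i]^o) <= l2norm v.
Proof.
rewrite -[leLHS]ger0_norm ?nrm_ge0// -sqrtr_sqr ler_sqrt.
  by rewrite (bigD1 i)//= lerDl sumr_ge0// => j _; rewrite sqr_ge0.
by rewrite sumr_ge0// => j _; rewrite sqr_ge0.
Qed.

Lemma l2norm_le_sum n (v : 'cV[R[i]]_n) : l2norm v <= \sum_i nrm (v i 0 : R[i]^o).
Proof.
rewrite -ler_sqr ?nnegrE ?l2norm_ge0 ?sumr_ge0// => [|i _]; last exact: nrm_ge0.
rewrite sqr_l2norm expr2 big_distrlr/=; apply: ler_sum => i _.
rewrite (bigD1 i)//= -expr2 lerDl sumr_ge0// => j _.
by rewrite mulr_ge0 ?nrm_ge0.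
Qed.

(** A crude bound for the operator norm, which shows that the sets whose suprema define [mxopnorm]
    and [mxsupnorm] are bounded above. *)
Definition entry_sum n (A : 'M[R[i]]_n) : R := \sum_i \sum_j nrm (A i j : R[i]^o).

Lemma l2norm_mulmx_le n (A : 'M[R[i]]_n) v :
  l2norm (A *m v) <= entry_sum A * l2norm v.
Proof.
apply: le_trans (l2norm_le_sum _) _; rewrite mulr_suml; apply: ler_sum => i _.
rewrite mxE; apply: le_trans (@ler_nrm_sum R R[i]^o _ _ _ _) _.
rewrite mulr_suml; apply: ler_sum => j _.
rewrite (@nrmZ R R[i]^o) ler_wpM2l ?nrm_ge0//; exact: nrm_le_l2norm.
Qed.

Lemma mxopnorm_ubound n (A : 'M[R[i]]_n) v : l2norm v <= 1 ->
  l2norm (A *m v) <= mxopnorm A.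
Proof.
move=> v1; apply: ub_le_sup; last by exists v.
exists (entry_sum A) => _ [w w1 <-]; apply: le_trans (l2norm_mulmx_le _ _) _.
rewrite ler_piMr// sumr_ge0// => i _; rewrite sumr_ge0// => j _; exact: nrm_ge0.
Qed.

Lemma mxopnorm_ge0 n (A : 'M[R[i]]_n) : 0 <= mxopnorm A.
Proof. by apply: sup_nneg => _ [v _ <-]; exact: l2norm_ge0. Qed.

Lemma mxopnorm_le_entry_sum n (A : 'M[R[i]]_n) : mxopnorm A <= entry_sum A.
Proof.
apply: ge_sup.
  exists (l2norm (A *m 0)), 0 => //=; rewrite /l2norm big1 ?sqrtr0// => i _.
  by rewrite mxE /nrm normr0 /= expr0n.
move=> _ [w w1 <-]; apply: le_trans (l2norm_mulmx_le _ _) _.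
rewrite ler_piMr// sumr_ge0// => i _; rewrite sumr_ge0// => j _; exact: nrm_ge0.
Qed.

Lemma l2norm_mxopnorm n (A : 'M[R[i]]_n) v :
  l2norm (A *m v) <= mxopnorm A * l2norm v.
Proof.
have [v0|vn0] := eqVneq (l2norm v) 0.
  by apply: le_trans (l2norm_mulmx_le _ _) _; rewrite v0 !mulr0.
have vp : 0 < l2norm v by rewrite lt_neqAle eq_sym vn0 l2norm_ge0.
have := @mxopnorm_ubound n A (((l2norm v)^-1)%:C *: v).
rewrite -scalemxAr !l2normZ gtr0_norm ?invr_gt0// mulVf// => /(_ (lexx _)).
by rewrite ler_pdivrMl// mulrC.
Qed.

Context (K : topologicalType) (cK : compact [set: K]).

Lemma CK_bounded (f : CK R[i] K) : exists2 B, 0 <= B & forall t, nrm (f t) <= B.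
Proof.
have [A hA] := bounded_part cK false f; have [B hB] := bounded_part cK true f.
exists `|A + B| => // t; apply: le_trans (ler_norm _).
by apply: le_trans (nrm_le_ReIm _) _; apply: lerD; [exact: hA|exact: hB].
Qed.

Definition at_point n (F : 'M[CK R[i] K]_n) (t : K) : 'M[R[i]]_n :=
  \matrix_(i, j) (F i j t : R[i]).

Lemma mxopnorm_at_point_le n (F : 'M[CK R[i] K]_n) t :
  mxopnorm (at_point F t) <= mxsupnorm F.
Proof.
have /choice[B hB] : forall p : 'I_n * 'I_n, exists B : R, forall t, nrm (F p.1 p.2 t) <= B.
  by move=> p; have [B _ ?] := CK_bounded (F p.1 p.2); exists B.
apply: ub_le_sup; last by exists t.
exists (\sum_i \sum_j B (i, j)) => _ [s _ <-].
apply: le_trans (mxopnorm_le_entry_sum _) _; apply: ler_sum => i _.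
by apply: ler_sum => j _; rewrite mxE; exact: (hB (i, j)).
Qed.

Lemma mxsupnorm_ge0 n (F : 'M[CK R[i] K]_n) : 0 <= mxsupnorm F.
Proof. by apply: sup_nneg => _ [t _ <-]; exact: mxopnorm_ge0. Qed.

End matrix_norms.

(** * Functions with disjoint supports *)

Section disjoint_family.
Context (R : realType) (K : topologicalType) (X : normedModType R[i]).
Context (u : CK R[i] K -> BX X) (M D : R).
Hypotheses (hu : bounded_homomorphism u) (M0 : 0 <= M).
Hypothesis uM : forall (f : CK R[i] K) (b : R) x, 0 <= b ->
  (forall t, nrm (f t) <= b) -> nrm (u f x) <= M * b * nrm x.
Hypotheses (D0 : 0 <= D) (hD : sign_alpha X D).

Lemma radsq_hom_le (I : finType) (f : CK R[i] K) (x : I -> X) :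
  (forall t, nrm (f t) <= 1) -> radsq (fun i => u f (x i)) <= M ^+ 2 * radsq x.
Proof.
move=> f1; rewrite /radsq -avgZ; apply: ler_avg => w.
rewrite (_ : \sum_i _ = u f (\sum_i ((-1) ^+ w i)%:C *: x i)); last first.
  by rewrite linear_sum; apply: eq_bigr => i _; rewrite linearZ.
rewrite -exprMn ler_sqr ?nnegrE ?mulr_ge0 ?nrm_ge0//.
by have := uM (\sum_i ((-1) ^+ w i)%:C *: x i) ler01 f1; rewrite mulr1.
Qed.

Context (T : finType) (n : nat) (psi : T -> CK R[i] K) (A : T -> 'M[R[i]]_n).
Variables (l L : R).
Hypothesis psi_disjoint : forall k k', k != k' -> psi k * psi k' = 0.
Hypothesis psi_le1 : forall (s : {ffun T -> bool}) t,
  nrm ((\sum_k ((-1) ^+ s k)%:C *: psi k : CK R[i] K) t) <= 1.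
Hypotheses (l0 : 0 <= l) (lL : l < L).
Hypothesis Al : forall k v, l2norm (A k *m v) <= l * l2norm v.

Lemma radsq_disjoint_hom_le (x : 'I_n -> X) :
  radsq (fun i => \sum_k u (psi k * psi k) (\sum_j A k i j *: x j)) <=
  M ^+ 4 * (16 * expR 1 * D ^+ 3) * L ^+ 2 * radsq x.
Proof.
pose S (s : {ffun T -> bool}) : CK R[i] K := \sum_k ((-1) ^+ s k)%:C *: psi k.
pose y (p : T * 'I_n) := u (psi p.1) (x p.2).
pose v k i := \sum_j A k i j *: y (k, j).
have uv k i : u (psi k) (\sum_j A k i j *: x j) = v k i.
  by rewrite linear_sum; apply: eq_bigr => j _; rewrite linearZ.
(* The family on the left is [u (S s)] applied to the signed sum of the [v k i]: cross terms vanish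
   by disjointness and equal signs square to 1. *)
have step1 (s : {ffun T -> bool}) :
    radsq (fun i => \sum_k u (psi k * psi k) (\sum_j A k i j *: x j)) <=
    M ^+ 2 * radsq (fun i => \sum_k ((-1) ^+ s k)%:C *: v k i).
  apply: le_trans (radsq_hom_le _ (psi_le1 s)).
  rewrite le_eqVlt; apply/orP; left; apply/eqP; apply: eq_radsq => i.
  rewrite linear_sum; apply: eq_bigr => k _.
  rewrite linearZ/= -uv -(homM hu) mulr_suml (hom_sum hu) (bigD1 k)//=.
  rewrite [X in _ *: (_ + X)]big1 ?addr0 => [|k' kk']; last first.
    by rewrite CK_scalerAl psi_disjoint// scaler0 (hom0 hu).
  rewrite CK_scalerAl (homZ hu) scalerA -rmorphM/= -signr_addb addbb expr0.
  by rewrite rmorph1 scale1r.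
(* The left side does not depend on [s], so the bound may be averaged over all signs. *)
have step2 : radsq (fun i => \sum_k u (psi k * psi k) (\sum_j A k i j *: x j)) <=
    M ^+ 2 * rad2sq v.
  rewrite rad2sqE -avgZ -[leLHS](avg_cst (T := {ffun T -> bool})) ?card_signs_gt0//.
  exact: ler_avg.
(* One factor [D] decouples the double sum into independent signs, a second comes from the
   contraction estimate. *)
have step3 : rad2sq v <= D * (L ^+ 2 * (16 * expR 1 * D * radsq y)).
  apply: le_trans (rad2sq_decouple_le hD _) _; rewrite ler_wpM2l//.
  exact: (radsq_contraction_le D0 hD y l0 lL Al).
(* Independent signs are turned back into products, and the signed sum of the [psi k] is absorbed
   into [u]. *)
have step4 : radsq y <= D * (M ^+ 2 * radsq x).
  apply: le_trans (radsq_decouple_le hD (fun k j => u (psi k) (x j))) _.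
  rewrite ler_wpM2l// rad2sqE; apply: avg_le => [|s].
    by rewrite mulr_ge0 ?sqr_ge0 ?radsq_ge0.
  apply: le_trans (radsq_hom_le _ (psi_le1 s)).
  rewrite le_eqVlt; apply/orP; left; apply/eqP; apply: eq_radsq => j.
  by rewrite (hom_sum hu); apply: eq_bigr => k _; rewrite (homZ hu).
apply: (le_trans step2).
apply: (@le_trans _ _ (M ^+ 2 * (D * (L ^+ 2 * (16 * expR 1 * D * (D * (M ^+ 2 * radsq x))))))); last first.
  by rewrite le_eqVlt; apply/orP; left; apply/eqP; ring.
rewrite ler_wpM2l ?sqr_ge0//; apply: (le_trans step3).
rewrite ler_wpM2l// ler_wpM2l ?sqr_ge0// ler_wpM2l//.
by rewrite !mulr_ge0 ?expR_ge0.
Qed.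

End disjoint_family.

(** The restriction [e <= 1] allows quadratic errors in [e] to be absorbed into linear ones. *)
Lemma le_of_perturbation (R : realType) (a b c : R) : 0 <= c ->
  (forall e, 0 < e -> e <= 1 -> a <= b + e * c) -> a <= b.
Proof.
move=> c0 h; apply/ler_addgt0Pr => e e0.
have c1 : 0 < c + 1 by lra.
pose d := Num.min 1 (e / (c + 1)).
have d0 : 0 < d by rewrite lt_min ltr01 divr_gt0.
have d1 : d <= 1 by rewrite ge_min lexx.
apply: (le_trans (h d d0 d1)); rewrite lerD2l.
apply: (@le_trans _ _ (d * (c + 1))); first by rewrite ler_wpM2l ?(ltW d0)//; lra.
by rewrite -ler_pdivlMr// ge_min lexx orbT.
Qed.

(** * Approximation of matrix-valued functions and conclusion *)

Section main.
Context (R : realType) (K : topologicalType) (X : normedModType R[i]).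
Hypothesis cK : compact [set: K].
Context (u : CK R[i] K -> BX X) (M D : R).
Hypotheses (hu : bounded_homomorphism u) (M0 : 0 <= M).
Hypothesis uM : forall (f : CK R[i] K) (b : R) x, 0 <= b ->
  (forall t, nrm (f t) <= b) -> nrm (u f x) <= M * b * nrm x.
Hypotheses (D0 : 0 <= D) (hD : sign_alpha X D).

Let C := M ^+ 4 * (16 * expR 1 * D ^+ 3).

Let C0 : 0 <= C.
Proof. by rewrite /C mulr_ge0 ?exprn_ge0// !mulr_ge0 ?exprn_ge0 ?expR_ge0. Qed.

Section approximation.
Context (n : nat) (F : 'M[CK R[i] K]_n) (x : 'I_n -> X) (B L h : R).
Hypotheses (B0 : 0 <= B) (FB : forall i j t, nrm (F i j t) <= B).
Hypotheses (FL : mxsupnorm F < L) (h0 : 0 < h).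

Let E := \sum_(i < n) \sum_(j < n) M * nrm (x j).

Lemma radsq_approx_le : radsq (fun i => \sum_j u (F i j) (x j)) <=
  2 * (C * L ^+ 2 * radsq x + (2 * h * (B + 1) * E) ^+ 2).
Proof.
pose g (p : 'I_n * 'I_n * bool) t := part p.2 (F p.1.1 p.1.2 t).
have [S [T [psi Hpsi]]] := @exists_splitting R K _ (enum {: 'I_n * 'I_n * bool}) g h h0
   (fun p => @continuous_part R K p.2 (F p.1.1 p.1.2))
   (fun p => bounded_part cK p.2 (F p.1.1 p.1.2)).
case: Hpsi => S0 pc p0 pd p1 pa po.
have osc i j s k t t' : psi s k t != 0 -> psi s k t' != 0 ->
    nrm (F i j t - F i j t') <= 2 * h.
  move=> ht ht'; apply: le_trans (nrm_le_ReIm _) _.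
  have H b := po (g (i, j, b)) s k t t' ltac:(by exists (i, j, b); rewrite ?mem_enum) ht ht'.
  have := H true; have := H false; rewrite /g /part/= -!raddfB/=; lra.
(* A value of [F] at some point of the support of [psi s k]; if there is none, 0 satisfies the same
   norm bound. *)
pose A s k : 'M[R[i]]_n := match pselect (exists t, psi s k t != 0) with
  | left ex => at_point F (projT1 (cid ex)) | right _ => 0 end.
have Al s k v : l2norm (A s k *m v) <= mxsupnorm F * l2norm v.
  rewrite /A; case: pselect => [ex|_].
    apply: le_trans (l2norm_mxopnorm _ _) _.
    by rewrite ler_wpM2r ?l2norm_ge0// mxopnorm_at_point_le.
  rewrite mul0mx (_ : l2norm 0 = 0) ?mulr_ge0 ?mxsupnorm_ge0 ?l2norm_ge0//.
  by rewrite /l2norm big1 ?sqrtr0// => i _; rewrite mxE /nrm normr0/= expr0n.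
have Aosc s k t i j : psi s k t != 0 -> nrm (F i j t - A s k i j : R[i]^o) <= 2 * h.
  move=> ht; rewrite /A; case: pselect => [ex|]; last by case; exists t.
  by rewrite mxE; apply: osc ht (projT2 (cid ex)).
pose Psi s k : CK R[i] K := realCK (pc s k).
pose G s i j : CK R[i] K := \sum_k A s k i j *: (Psi s k * Psi s k).
pose G' i j : CK R[i] K := (#|S|%:R^-1)%:C *: \sum_s G s i j.
(* For fixed [s], with [a] the sum of the [psi s k t], the error is at most [(1 - a^2) B + 2 h a^2
   <= 2 (1 - a) B + 2 h]; on average over [s], [1 - a] is at most [h]. *)
have err i j t : nrm ((F i j - G' i j) t) <= 2 * h * (B + 1).
  pose z : R[i] := F i j t.
  pose W s : R[i] := z - \sum_k A s k i j * (psi s k t ^+ 2)%:C.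
  have -> : (F i j - G' i j) t = \sum_s (#|S|%:R^-1 : R)%:C * W s.
    rewrite CKB CKZ CK_sum -mulr_sumr /W sumrB mulrBr; congr (_ - _).
      rewrite sumr_const -/z -[z *+ _]mulr_natl mulrA.
      by rewrite fmorphV rmorph_nat mulVf ?mul1r// pnatr_eq0 -lt0n.
    congr (_ * _); apply: eq_bigr => s _; rewrite CK_sum; apply: eq_bigr => k _.
    by rewrite CKZ CKM -rmorphM.
  have avg1 : \sum_s #|S|%:R^-1 * (2 * B * (1 - \sum_k psi s k t) + 2 * h) <=
      2 * h * (B + 1).
    rewrite -mulr_sumr -/(avg _) avgD avgZ avg_cst// avgD avg_cst//.
    rewrite (eq_avg (g := fun s => -1 * \sum_k psi s k t)); last by move=> s; rewrite mulN1r.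
    rewrite avgZ mulN1r; have := pa t; set a := avg _ => ha.
    have : B * (1 - a) <= B * h by rewrite ler_wpM2l//; lra.
    lra.
  apply: le_trans (@ler_nrm_sum R R[i]^o _ _ _ _) _.
  apply: le_trans avg1; apply: ler_sum => s _.
  rewrite (@nrmZR R R[i]^o) ger0_norm ?invr_ge0// ler_wpM2l ?invr_ge0//.
  set a := \sum_k psi s k t.
  have a0 : 0 <= a by apply: sumr_ge0 => k _.
  have a1 : a <= 1 by exact: p1.
  (* Disjointness of the supports removes the cross terms. *)
  have sq : \sum_k psi s k t ^+ 2 = a ^+ 2.
    rewrite [RHS]expr2 big_distrlr/=; apply: eq_bigr => k _.
    rewrite (bigD1 k)//= [X in _ + X]big1 ?addr0 ?expr2// => k' kk'.
    by rewrite pd// eq_sym.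
  have -> : W s = (1 - a ^+ 2)%:C * z + \sum_k (psi s k t ^+ 2)%:C * (z - A s k i j).
    under eq_bigr => k _ do rewrite mulrBr.
    rewrite sumrB -mulr_suml -rmorph_sum/= sq rmorphB/= rmorph1 mulrBl mul1r addrA subrK.
    by rewrite /W; congr (_ - _); apply: eq_bigr => k _; rewrite mulrC.
  apply: le_trans (@ler_nrmD R R[i]^o _ _) _; apply: lerD.
    rewrite (@nrmZR R R[i]^o) ger0_norm; last by rewrite subr_ge0 expr_le1.
    rewrite [leRHS](_ : _ = (2 * (1 - a)) * B); last by ring.
    apply: ler_pM; [by rewrite subr_ge0 expr_le1|exact: nrm_ge0| |exact: FB].
    by have := sqr_ge0 (1 - a); rewrite !expr2; nra.
  apply: le_trans (@ler_nrm_sum R R[i]^o _ _ _ _) _.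
  apply: (@le_trans _ _ (\sum_k psi s k t ^+ 2 * (2 * h))).
    apply: ler_sum => k _; rewrite (@nrmZR R R[i]^o) ger0_norm ?sqr_ge0//.
    have [->|nz] := eqVneq (psi s k t) 0; first by rewrite expr0n !mul0r.
    by rewrite ler_wpM2l ?sqr_ge0// Aosc.
  rewrite -mulr_suml sq ler_piMl ?mulr_ge0 ?(ltW h0)// expr_le1//.
have -> : radsq (fun i => \sum_j u (F i j) (x j)) =
   radsq (fun i => \sum_j u (G' i j) (x j) + \sum_j u (F i j - G' i j) (x j)).
  apply: eq_radsq => i; rewrite -big_split/=; apply: eq_bigr => j _.
  by rewrite -(homD hu) addrC subrK.
apply: le_trans (radsqD_le _ _) _; rewrite ler_wpM2l// lerD//.
(* Main term: by convexity it is enough to bound each [s], where the supports are disjoint. *)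
- rewrite (eq_radsq (y := fun i => (#|S|%:R^-1)%:C *: \sum_s \sum_j u (G s i j) (x j))).
    apply: radsq_avg_le => [|s].
      exact: mulr_ge0 (mulr_ge0 C0 (sqr_ge0 L)) (radsq_ge0 x).
    rewrite (eq_radsq (y := fun i => \sum_k u (Psi s k * Psi s k) (\sum_j A s k i j *: x j))).
      apply: (radsq_disjoint_hom_le hu M0 uM D0 hD _ _ (mxsupnorm_ge0 F) FL (Al s)).
      + move=> k k' kk'; apply: CK_eq => t; rewrite CKM -rmorphM/=.
        by rewrite pd.
      + move=> e t; rewrite CK_sum.
        apply: le_trans (ler_nrm_sum _ _ _) _.
        apply: le_trans (p1 s t); apply: ler_sum => k _.
        rewrite CKZ -rmorphM/= nrmR normrM normrX normrN normr1 expr1n mul1r.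
        by rewrite ger0_norm.
    move=> i; under eq_bigr => j _ do rewrite (hom_sum hu).
    rewrite exchange_big/=; apply: eq_bigr => k _; rewrite linear_sum.
    by apply: eq_bigr => j _; rewrite (homZ hu) linearZ.
  move=> i; rewrite exchange_big scaler_sumr/=; apply: eq_bigr => j _.
  by rewrite (homZ hu) (hom_sum hu).
(* Error term: the triangle inequality gives a bound uniform in the signs. *)
- have e0 : 0 <= 2 * h * (B + 1) by rewrite mulr_ge0 ?addr_ge0// mulr_ge0// ltW.
  apply: avg_le => [|w]; first exact: sqr_ge0.
  rewrite ler_sqr ?nnegrE ?nrm_ge0//; last first.
    rewrite mulr_ge0//; apply: sumr_ge0 => i _; apply: sumr_ge0 => j _.
    by rewrite mulr_ge0 ?nrm_ge0.
  apply: le_trans (ler_nrm_sum _ _ _) _; rewrite /E mulr_sumr; apply: ler_sum => i _.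
  rewrite nrmZR normrX normrN normr1 expr1n mul1r mulr_sumr.
  apply: le_trans (ler_nrm_sum _ _ _) _; apply: ler_sum => j _.
  by rewrite [leRHS]mulrA [_ * M]mulrC; exact: uM.
Qed.

End approximation.

(** The approximation is used with [L = mxsupnorm F + e] and [h = e], and [e] tends to 0. *)
Lemma radsq_hom_matrix_le n (F : 'M[CK R[i] K]_n) (x : 'I_n -> X) :
  radsq (fun i => \sum_j u (F i j) (x j)) <= 2 * (C * mxsupnorm F ^+ 2 * radsq x).
Proof.
have /choice[Bf hB] : forall p : 'I_n * 'I_n, exists B : R,
    0 <= B /\ forall t, nrm (F p.1 p.2 t) <= B.
  by move=> p; have [B ? ?] := CK_bounded cK (F p.1 p.2); exists B.
pose B := \sum_p Bf p.
have B0 : 0 <= B by apply: sumr_ge0 => p _; have [] := hB p.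
have FB i j t : nrm (F i j t) <= B.
  apply: le_trans ((hB (i, j)).2 t) _; rewrite /B (bigD1 (i, j))//= lerDl.
  by apply: sumr_ge0 => p _; have [] := hB p.
set m := mxsupnorm F; have m0 : 0 <= m by exact: mxsupnorm_ge0.
have Q0 := radsq_ge0 x; set Q := radsq x in Q0 *.
pose c := (2 * (B + 1) * \sum_(i < n) \sum_(j < n) M * nrm (x j)) ^+ 2.
have c0 : 0 <= c by exact: sqr_ge0.
apply: (@le_of_perturbation _ _ _ (2 * (C * (2 * m + 1) * Q + c))).
  have m1 : 0 <= 2 * m + 1 by lra.
  by rewrite mulr_ge0// addr_ge0// mulr_ge0// mulr_ge0.
move=> e e0 e1.
have := @radsq_approx_le n F x B (m + e) e B0 FB ltac:(by rewrite ltrDl) e0.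
move=> /le_trans; apply.
rewrite -/Q (_ : (2 * e * (B + 1) * _) ^+ 2 = e * (e * c)); last by rewrite /c; ring.
have -> : 2 * (C * m ^+ 2 * Q) + e * (2 * (C * (2 * m + 1) * Q + c)) =
   2 * (C * (m ^+ 2 + e * (2 * m + 1)) * Q + e * c) by ring.
rewrite ler_wpM2l// lerD//; last by rewrite ler_wpM2l ?(ltW e0)// ler_piMl.
rewrite ler_wpM2r// ler_wpM2l//; nra.
Qed.

End main.

Theorem proposition4p4 (R : realType)
  (d : measure_display) (Omega : measurableType d) (P : probability Omega R)
  (eps : nat -> {RV P >-> R}) (heps : rademacher_sequence eps)
  (K : topologicalType) (hK : hausdorff_space K) (cK : compact [set: K])
  (X : completeNormedModType R[i]) (hX : property_alpha eps X)
  (u : CK R[i] K -> BX X) (hu : bounded_homomorphism u) :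
  exists2 C : R, 0 <= C &
    forall (n : nat) (F : 'M[CK R[i] K]_n), (1 <= n)%N ->
      (R_norm eps (fun i j => u (F i j)) <= (C * mxsupnorm F)%:E)%E.
Proof.
have [D D0 hD] := property_alpha_sign heps hX.
have [M M0 uM] := hom_bound hu.
(* The 2 comes from splitting off the approximation error; the root is taken because all estimates
   concern squared norms. *)
pose c := 2 * (M ^+ 4 * (16 * expR 1 * D ^+ 3)).
have c0 : 0 <= c by rewrite /c !mulr_ge0 ?exprn_ge0 ?expR_ge0.
exists (Num.sqrt c); first exact: sqrtr_ge0.
move=> n F _; apply: ge_ereal_sup => _ [x /= x1 <-]; rewrite lee_fin.
rewrite -ler_sqr ?nnegrE ?mulr_ge0 ?sqrtr_ge0 ?mxsupnorm_ge0//.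
rewrite exprMn [Num.sqrt c ^+ 2]sqr_sqrtr//.
have -> : \sum_(i < n) \sum_(j < n) tens eps i (u (F i j) (x j)) =
    \sum_(i < n) tens eps i (\sum_(j < n) u (F i j) (x j)).
  apply: eq_bigr => i _; apply/funext => w; rewrite fct_sumE /tens scaler_sumr.
  by [].
rewrite (sqr_Rad_norm heps).
apply: le_trans (radsq_hom_matrix_le cK hu M0 uM D0 hD F x) _.
rewrite mulrA mulrA -/c ler_piMr//; first by rewrite mulr_ge0 ?sqr_ge0.
rewrite -(sqr_Rad_norm heps) expr_le1//; exact: sqrtr_ge0.
Qed.
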